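(* Let $X_0\subset\mathbb{P}^6$ be the singular del Pezzo surface of degree $6$ described in the context. Then the saturation number satisfies $r(X_0(\mathbb{Z}),x_0\cdots x_6)\leq 45$; that is, the set of primitive vectors $\mathbf{x}=(x_0,\ldots,x_6)\in\mathbb{Z}^7$ with $[\mathbf{x}]\in X_0$ and such that $x_0\cdots x_6$ is a product of at most $45$ primes is Zariski dense in $X_0$.
   Context: $X_0\subset\mathbb{P}^6$ denotes a (split) singular del Pezzo surface of degree $6$ defined over $\mathbb{Q}$, anticanonically embedded as an intersection of $9$ quadrics, with a single singularity of type $\mathbf{A}_2$ and with both of its two lines defined over $\mathbb{Q}$. Concretely, $X_0$ is the image of the affine hypersurface $\eta_2\alpha_1^2+\eta_3\alpha_2+\eta_4\alpha_3=0$ in $\mathbb{A}^7$ (coordinates $\eta_1,\ldots,\eta_4,\alpha_1,\alpha_2,\alpha_3$) under the morphism $(\boldsymbol\eta,\boldsymbol\alpha)\mapsto(\alpha_2\alpha_3,\ \eta^{(1,1,1,0)}\alpha_1\alpha_2,\ \eta^{(1,1,0,1)}\alpha_1\alpha_3,\ \eta^{(2,1,2,1)}\alpha_2,\ \eta^{(2,1,1,2)}\alpha_3,\ \eta^{(4,2,3,3)},\ \eta^{(3,2,2,2)}\alpha_1)$, where $\eta^{(a,b,c,d)}=\eta_1^a\eta_2^b\eta_3^c\eta_4^d$ (more precisely, the Zariski closure of the image of the open subset where this is defined). Rational points of $X_0$ are identified with primitive integer vectors $\mathbf{x}\in\mathbb{Z}^7$ (up to sign), giving $X_0(\mathbb{Z})$.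 The saturation number $r(X_0(\mathbb{Z}),x_0\cdots x_6)$ is the least $r$ such that the set of $\mathbf{x}\in\mathbb{Z}^7$ with $[\mathbf{x}]\in X_0(\mathbb{Z})$ and $x_0\cdots x_6$ a product of at most $r$ primes (counted with multiplicity, up to sign) is Zariski dense in $X_0$. *)

(* Defs.v *)
From mathcomp Require Import all_boot all_order all_algebra all_field.
From mathcomp Require Import mpoly.

Set Implicit Arguments.
Unset Strict Implicit.
Unset Printing Implicit Defensive.

Import Order.TTheory GRing.Theory Num.Theory.

Local Open Scope ring_scope.

(* Subsets of projective (n-1)-space over algC (the algebraic closure of the
   rationals) are given by their homogeneous coordinate vectors, the rows in
   'rV[algC]_n.  The vanishing of a homogeneous polynomial does not depend on
   the choice of coordinates, so no scaling condition is needed below. *)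
Definition proj_zariski_closure (n : nat) (S : 'rV[algC]_n -> Prop)
    (x : 'rV[algC]_n) : Prop :=
  x != 0 /\
  forall (d : nat) (p : {mpoly algC[n]}), p \is d.-homog ->
    (forall y, S y -> p.@[y 0] = 0) -> p.@[x 0] = 0.

Definition zariski_dense_in (n : nat) (S X : 'rV[algC]_n -> Prop) : Prop :=
  (forall x, S x -> X x) /\ (forall x, X x -> proj_zariski_closure S x).

Definition primitive_vector (n : nat) (x : 'rV[int]_n) : Prop :=
  \big[gcdn/0%N]_(i < n) `|(x 0 i)%R|%N = 1%N.

(* In particular m is nonzero; the empty product 1 is allowed. *)
Definition product_of_at_most_primes (r m : nat) : Prop :=
  exists s : seq nat,
    [/\ all prime s, (size s <= r)%N & m = (\prod_(q <- s) q)%N].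

Definition integral_point (n : nat) (X : 'rV[algC]_n -> Prop)
    (x : 'rV[int]_n) : Prop :=
  primitive_vector x /\ X (map_mx intr x).

Definition almost_prime_points (n : nat) (X : 'rV[algC]_n -> Prop)
    (f : {mpoly int[n]}) (r : nat) (y : 'rV[algC]_n) : Prop :=
  exists x : 'rV[int]_n,
    [/\ integral_point X x, product_of_at_most_primes r `|(f.@[x 0])%R|%N
      & y = map_mx intr x].

Definition is_saturation_number (n : nat) (X : 'rV[algC]_n -> Prop)
    (f : {mpoly int[n]}) (r : nat) : Prop :=
  zariski_dense_in (almost_prime_points X f r) X /\
  forall r', zariski_dense_in (almost_prime_points X f r') X -> (r <= r')%N.

Definition cox_map (R : comNzRingType) (e1 e2 e3 e4 a1 a2 a3 : R) : 'rV[R]_7 :=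
  let mon a b c d := e1 ^+ a * e2 ^+ b * e3 ^+ c * e4 ^+ d in
  \row_(i < 7)
    [:: a2 * a3;
        mon 1 1 1 0 * a1 * a2;
        mon 1 1 0 1 * a1 * a3;
        mon 2 1 2 1 * a2;
        mon 2 1 1 2 * a3;
        mon 4 2 3 3;
        mon 3 2 2 2 * a1]`_i.

(* The induced rational map to projective space is undefined exactly where all
   seven coordinates vanish. *)
Definition cox_image (y : 'rV[algC]_7) : Prop :=
  exists e1 e2 e3 e4 a1 a2 a3 : algC,
    [/\ e2 * a1 ^+ 2 + e3 * a2 + e4 * a3 = 0,
        y = cox_map e1 e2 e3 e4 a1 a2 a3 & y != 0].

Definition X0 : 'rV[algC]_7 -> Prop := proj_zariski_closure cox_image.

Definition coord_product : {mpoly int[7]} := \prod_(i < 7) 'X_i.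

(* Main.v *)
Require Import Defs.
From mathcomp Require Import all_boot all_order all_algebra all_field.
From mathcomp Require Import mpoly.
From Stdlib Require Import Classical_Prop.
From mathcomp Require Import zify ring lra.

(** On the chart [eta = (1,1,1,1)] the surface is the affine plane: the point
    with [alpha_1 = a], [alpha_2 = b] has coordinates
    [(b c, a b, a c, b, c, 1, a)] with [c = - (a^2 + b)].  It is primitive, and
    the product of its coordinates is [(a b c)^3] up to sign, so it suffices that
    [a b c] be a product of at most 15 primes for a dense set of [(a, b)].  Fix an
    odd prime [a] and put [b = 2 m]; a two-dimensional sieve must then provide
    infinitely many [m] for which [m (2 m + a^2)] has at most 13 prime factors.

    Sieve [m < N = z^22] with the Brun-Hooley sieve by the primes up to [z], the
    sifting range being cut at the repeated square roots of [z], and give each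
    prime divisor in [(z, z^8]] the Kuhn weight 1/10.  A surviving [m] has at
    most 9 prime factors in that range, and each of [m], [2 m + a^2] is smaller
    than [z^24] and so has at most 2 larger ones.  Only an upper bound for the
    sum of [1/p] over [x < p <= x^2], close to [log 2], is needed; it follows from
    the size and the factorisation of multinomial coefficients, so that no
    logarithm ever appears.

    A polynomial vanishing at these points vanishes on the chart, by letting [b]
    and then [a] vary; by homogeneity it vanishes wherever all [eta_i] are nonzero, and
    the remaining points are reached along curves. *)

Set Implicit Arguments.
Unset Strict Implicit.
Unset Printing Implicit Defensive.

Import Order.TTheory GRing.Theory Num.Theory.

(** * Reciprocal sums of primes *)

Definition primes_in (u v : nat) : seq nat :=
  [seq p <- index_iota u.+1 v.+1 | prime p].

Lemma mem_primes_in u v p : (p \in primes_in u v) = [&& prime p, u < p & p <= v].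
Proof. by rewrite mem_filter mem_index_iota. Qed.

Lemma primes_in_uniq u v : uniq (primes_in u v).
Proof. by rewrite filter_uniq ?iota_uniq. Qed.

Lemma primes_in_cat u v w : u <= v <= w ->
  primes_in u w = primes_in u v ++ primes_in v w.
Proof.
case/andP=> uv vw; rewrite /primes_in -filter_cat /index_iota !subSS.
have -> : w - u = (v - u) + (w - v) by lia.
by rewrite iotaD (_ : u.+1 + (v - u) = v.+1) //; lia.
Qed.

(** A single term, the one of index [m], of the binomial expansion of [(x + 1) ^ ((x + 1) m)]. *)
Lemma bin_mul_exp_le x m : 'C(x.+1 * m, m) * x ^ (x * m) <= x.+1 ^ (x.+1 * m).
Proof.
have -> : x * m = x.+1 * m - m by rewrite mulSn addKn.
rewrite -[X in _ <= X ^ _]addn1 expnDn.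
have lt_m : m < (x.+1 * m).+1 by rewrite ltnS leq_pmull.
by rewrite (bigD1 (Ordinal lt_m)) //= exp1n muln1 leq_addr.
Qed.

Lemma bin_fact_mul x m : (x.+1 * m)`! = 'C(x.+1 * m, m) * m`! * (x * m)`!.
Proof. by rewrite -mulnA -(bin_fact (m := m)) ?leq_pmull // mulSn addKn. Qed.

Lemma fact_mul_le x m : (x * m)`! <= x ^ (x * m) * m`! ^ x.
Proof.
elim: x => [|x IHx] //; rewrite bin_fact_mul.
apply: leq_trans (leq_mul (leqnn _) IHx) _.
by rewrite [X in _ <= _ * X]expnS mulnACA leq_mul // bin_mul_exp_le.
Qed.

Lemma dvdn_fact_mul x m : m`! ^ x %| (x * m)`!.
Proof.
elim: x => [|x IHx]; first by rewrite expn0 dvd1n.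
by rewrite bin_fact_mul expnS dvdn_mul // dvdn_mull.
Qed.

(** Legendre's formula, of which only the first term is kept. *)
Lemma logn_fact_ge p n : prime p -> n %/ p <= logn p n`!.
Proof.
move=> p_pr; rewrite logn_fact //; case: n => [|n]; first by rewrite div0n.
by rewrite big_ltn // expn1 leq_addr.
Qed.

Lemma dvdn_prime_fact p m : prime p -> (p %| m`!) = (p <= m).
Proof.
move=> p_pr; apply/idP/idP => [|pm]; last by rewrite dvdn_fact ?prime_gt0.
elim: m => [|m IHm]; first by rewrite dvdn1 => /eqP p1; rewrite p1 in p_pr.
by rewrite factS Euclid_dvdM // => /orP[/dvdn_leq -> //|/IHm/leqW].
Qed.

(** The induction moves one prime power at a time into the divisor [d], which stays prime to the
    remaining elements of [s]. It is used with [d] a power of [m!] and primes above [m]. *)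
Lemma prod_coprime_dvdn (s : seq nat) (e : nat -> nat) d n :
  uniq s -> all prime s -> (forall p, p \in s -> ~~ (p %| d)) ->
  d %| n -> (forall p, p \in s -> p ^ e p %| n) ->
  (\prod_(p <- s) p ^ e p) * d %| n.
Proof.
elim: s d => [|p s IHs] d; first by rewrite big_nil mul1n.
case/andP=> pNs uniq_s /andP[p_pr prs] nd dn en.
rewrite big_cons mulnC mulnA mulnC; apply: IHs => // [q qs||q qs]; last 1 first.
- by apply: en; rewrite inE qs orbT.
- have q_pr := allP prs q qs.
  rewrite Euclid_dvdM // negb_or; apply/andP; split.
    by apply: nd; rewrite inE qs orbT.
  rewrite Euclid_dvdX // dvdn_prime2 //; apply/negP => /andP[/eqP qp _].
  by rewrite -qp qs in pNs.
- rewrite Gauss_dvd ?dn ?en ?inE ?eqxx // coprimeXr // coprime_sym prime_coprime //.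
  by apply: nd; rewrite inE eqxx.
Qed.

(* The multinomial coefficient (x m)! / (m!)^x is at most x^(x m), and it is
   divisible by p^(floor (x m / p)) for each prime p in (m, x m]. *)
Lemma prod_primes_in_le x m :
  \prod_(p <- primes_in m (x * m)) p ^ (x * m %/ p) <= x ^ (x * m).
Proof.
have m_gt0 : 0 < m`! ^ x by rewrite expn_gt0 fact_gt0.
rewrite -(leq_pmul2r m_gt0); apply: leq_trans (fact_mul_le x m).
apply: dvdn_leq; first exact: fact_gt0.
apply: prod_coprime_dvdn (dvdn_fact_mul x m) _; first exact: primes_in_uniq.
- by apply/allP => p; rewrite mem_primes_in => /andP[].
- move=> p; rewrite mem_primes_in => /and3P[p_pr mp _].
  by rewrite Euclid_dvdX // dvdn_prime_fact // leqNgt mp.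
- move=> p; rewrite mem_primes_in => /and3P[p_pr _ _].
  by rewrite pfactor_dvdn ?fact_gt0 // logn_fact_ge.
Qed.

(** The logarithm to base [x] of [prod_primes_in_le]: each prime exceeds [m >= x ^ k], so its
    logarithm is at least the integer [k]. *)
Lemma sum_divn_primes_in_le x m k : 1 < x -> x ^ k <= m ->
  k * (\sum_(p <- primes_in m (x * m)) x * m %/ p) <= x * m.
Proof.
move=> x_gt1 xkm; rewrite -(leq_exp2l _ _ x_gt1).
apply: leq_trans (prod_primes_in_le x m).
rewrite expnM expn_sum big_seq [X in _ <= X]big_seq; apply: leq_prod => p.
rewrite mem_primes_in => /and3P[_ mp _].
have [->|e_gt0] := posnP (x * m %/ p); rewrite ?expn0 // leq_exp2r //.
exact: leq_trans xkm (ltnW mp).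
Qed.

(** A Chebyshev bound: with [x = Z] and [m = Z ^ j], every quotient in the preceding sum is at least
    1. *)
Lemma size_primes_in_le Z j : 1 < Z ->
  j * size (primes_in (Z ^ j) (Z ^ j.+1)) <= Z ^ j.+1.
Proof.
move=> Z_gt1; rewrite expnS.
apply: leq_trans (sum_divn_primes_in_le Z_gt1 (leqnn _)).
rewrite leq_mul2l -sum1_size big_seq [X in _ <= X]big_seq; apply/orP; right.
apply: leq_sum => p; rewrite mem_primes_in => /and3P[p_pr _ le_p].
by rewrite divn_gt0 ?prime_gt0.
Qed.

Lemma size_primes_in_sub v u w : u <= w ->
  size (primes_in v w) <= size (primes_in v u) + size (primes_in u w).
Proof.
move=> uw; have [vu|uv] := leqP v u.
  by rewrite (@primes_in_cat v u w) ?vu ?uw // size_cat.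
apply: leq_trans (leq_addl _ _); apply: uniq_leq_size (primes_in_uniq _ _) _.
move=> p; rewrite !mem_primes_in => /and3P[-> vp ->].
by rewrite (ltn_trans uv vp).
Qed.

Lemma size_primes_in_le_bound u v : size (primes_in u v) <= v - u.
Proof. by rewrite size_filter (leq_trans (count_size _ _)) // size_iota subSS. Qed.

Local Open Scope ring_scope.

(** The numbers up to [Z ^ j] are a proportion [1 / Z] of the whole range and are all counted; the
    primes beyond contribute at most [1 / j]. *)
Lemma prime_density_le Z j : (1 < Z)%N -> (0 < j)%N ->
  (size (primes_in 0 (Z ^ j.+1)))%:R / (Z ^ j.+1)%:R
    <= j%:R^-1 + Z%:R^-1 :> rat.
Proof.
move=> Z_gt1 j_gt0; set n := (Z ^ j.+1)%N.
have Zr_gt0 : 0 < Z%:R :> rat by rewrite ltr0n ltnW.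
have n_gt0 : 0 < n%:R :> rat by rewrite ltr0n expn_gt0 ltnW.
have jr_gt0 : 0 < j%:R :> rat by rewrite ltr0n.
rewrite ler_pdivrMr // mulrDl.
have le1 : (size (primes_in 0 n) <= Z ^ j + size (primes_in (Z ^ j) n))%N.
  have Zjn : (Z ^ j <= n)%N by rewrite leq_exp2l.
  apply: leq_trans (size_primes_in_sub 0 Zjn) _.
  by rewrite leq_add2r (leq_trans (size_primes_in_le_bound _ _)) ?subn0.
have := size_primes_in_le j Z_gt1; rewrite -/n => le2.
have {}le1 : (size (primes_in 0 n))%:R
    <= (Z ^ j)%:R + (size (primes_in (Z ^ j) n))%:R :> rat.
  by rewrite -natrD ler_nat.
have {}le2 : j%:R * (size (primes_in (Z ^ j) n))%:R <= n%:R :> rat.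
  by rewrite -natrM ler_nat.
apply: le_trans le1 _; rewrite addrC lerD //.
  by rewrite ler_pdivlMl.
by rewrite /n expnS natrM mulKf ?gt_eqF.
Qed.

(** Replacing [n / p] by its integer part costs at most 1 for each prime, and the prime density
    bounds this cost. *)
Lemma sum_inv_primes_in_le X k : (1 < X)%N -> (0 < k)%N ->
  \sum_(p <- primes_in (X ^ k) (X ^ k.+1)) p%:R^-1
    <= k%:R^-1 + (size (primes_in 0 (X ^ k.+1)))%:R / (X ^ k.+1)%:R :> rat.
Proof.
move=> X_gt1 k_gt0; set n := (X ^ k.+1)%N.
have n_gt0 : 0 < n%:R :> rat by rewrite ltr0n expn_gt0 ltnW.
have kr_gt0 : 0 < k%:R :> rat by rewrite ltr0n.
have := sum_divn_primes_in_le X_gt1 (leqnn (X ^ k)); rewrite -expnS -/n => le_n.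
have {}le_n : k%:R * (\sum_(p <- primes_in (X ^ k) n) n %/ p)%N%:R <= n%:R :> rat.
  by rewrite -natrM ler_nat.
have size_le : (size (primes_in (X ^ k) n) <= size (primes_in 0 n))%N.
  have Xkn : (0 <= X ^ k <= n)%N by rewrite leq_exp2l ?leqnSn.
  by rewrite (primes_in_cat Xkn) size_cat leq_addl.
rewrite -(ler_pM2r n_gt0) [leRHS]mulrDl divfK ?gt_eqF //.
apply: (@le_trans _ _ ((\sum_(p <- primes_in (X ^ k) n) n %/ p)%N%:R
                        + (size (primes_in 0 n))%:R)).
  apply: (@le_trans _ _ ((\sum_(p <- primes_in (X ^ k) n) n %/ p)%N%:R
                        + (size (primes_in (X ^ k) n))%:R)); last first.
    by rewrite lerD2l ler_nat.
  rewrite -sum1_size -natrD -big_split /= natr_sum mulr_suml.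
  rewrite big_seq [leRHS]big_seq; apply: ler_sum => p.
  rewrite mem_primes_in => /and3P[p_pr _ _]; have p_gt0 := prime_gt0 p_pr.
  rewrite ler_pdivrMl ?ltr0n // -natrM ler_nat mulnC addn1.
  exact: ltnW (ltn_ceil _ _).
by rewrite lerD2r ler_pdivlMl.
Qed.

Lemma inv_natr_le m n : (0 < m <= n)%N -> n%:R^-1 <= m%:R^-1 :> rat.
Proof.
by case/andP=> m_gt0 mn; rewrite lef_pV2 ?ler_nat // posrE ltr0n ?(leq_trans m_gt0).
Qed.

(* 1/6 + ... + 1/11 < 0.7366, an upper Riemann sum for log 2. *)
Lemma sum_inv_primes_square_le (Z : nat) : (10000 <= Z)%N ->
  \sum_(p <- primes_in (Z ^ 600) ((Z ^ 600) ^ 2)) p%:R^-1 <= 746%:R / 1000%:R :> rat.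
Proof.
(* The range is [(X ^ 6, X ^ 12]], cut at the powers of [X] into six intervals. *)
move=> Z_ge; set X := (Z ^ 100)%N.
have Z_gt1 : (1 < Z)%N by apply: leq_trans Z_ge.
have X_gt1 : (1 < X)%N by rewrite -(exp1n 100) ltn_exp2r.
have -> : (Z ^ 600)%N = (X ^ 6)%N by rewrite -expnM.
rewrite -expnM; have iZ : Z%:R^-1 <= 10000%:R^-1 :> rat.
  by apply: inv_natr_le; rewrite Z_ge.
have step k : (5 < k)%N ->
    \sum_(p <- primes_in (X ^ k) (X ^ k.+1)) p%:R^-1 <= k%:R^-1 + 154%:R / 100000%:R :> rat.
  move=> k_gt5; apply: le_trans (sum_inv_primes_in_le X_gt1 _) _.
    by apply: ltnW; apply: leq_trans k_gt5.
  rewrite lerD2l.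
  (* As a power of the smaller base [Z], the endpoint has a large exponent: the density is at most
     [1/699 + 1/10000 < 0.00154], and six such errors keep the total below 0.746. *)
  have -> : (X ^ k.+1)%N = (Z ^ (99 + 100 * k).+1)%N by rewrite -expnM mulnS.
  apply: le_trans (prime_density_le Z_gt1 _) _; first by [].
  have : (99 + 100 * k)%:R^-1 <= 699%:R^-1 :> rat.
    by apply: inv_natr_le; lia.
  lra.
have cat k : (5 < k)%N -> 
  \sum_(p <- primes_in (X ^ 6) (X ^ k.+1)) p%:R^-1
   = \sum_(p <- primes_in (X ^ 6) (X ^ k)) p%:R^-1
   + \sum_(p <- primes_in (X ^ k) (X ^ k.+1)) p%:R^-1 :> rat.
  move=> k_gt5; rewrite (@primes_in_cat (X ^ 6) (X ^ k)) ?big_cat //.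
  by rewrite !leq_exp2l // k_gt5 leqnSn.
rewrite (cat 11 isT) (cat 10 isT) (cat 9 isT) (cat 8 isT) (cat 7 isT).
have := (step 6 isT, (step 7 isT, step 8 isT, step 9 isT, step 10 isT, step 11 isT)).
case=> h6 [[[[h7 h8] h9] h10] h11].
move: h6 h7 h8 h9 h10 h11; lra.
Qed.

Lemma double_inv_shift_le (p c : rat) : 1000%:R < p -> c = 1003%:R / 1000%:R ->
  2 / (p - 2) <= 2 * c * p^-1.
Proof.
move=> lt_p c_eq.
have p_gt0 : 0 < p by move: lt_p; lra.
have p2_gt0 : 0 < p - 2 by move: lt_p; lra.
rewrite ler_pdivrMr; last by exact: p2_gt0.
rewrite mulrAC.
rewrite ler_pdivlMr; last by exact: p_gt0.
move: lt_p; rewrite c_eq {c_eq p_gt0 p2_gt0}; lra.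
Qed.

(** The summand is the [h] with [(1 + h) (1 - 2 / p) = 1], the form in which [prod_one_sub_ge] takes
    it. Numerically, [2 * 1.003 * 0.746 < 3 / 2]. *)
Lemma sum_double_inv_primes_square_le (Z : nat) : (10000 <= Z)%N ->
  \sum_(p <- primes_in (Z ^ 600) ((Z ^ 600) ^ 2)) 2 / (p%:R - 2)
    <= 3 / 2 :> rat.
Proof.
move=> Z_ge; have := sum_inv_primes_square_le Z_ge.
have : (10000 <= Z ^ 600)%N.
  have Z_gt0 : (0 < Z)%N by apply: leq_trans Z_ge.
  by apply: leq_trans Z_ge _; rewrite -{1}[Z]expn1 leq_pexp2l.
move: (Z ^ 600)%N => u u_ge h.
pose c : rat := 1003%:R / 1000%:R.
have c_eq : c = 1003%:R / 1000%:R := erefl; clearbody c.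
apply: (@le_trans _ _ (2 * c * \sum_(p <- primes_in u (u ^ 2)) p%:R^-1)).
  rewrite mulr_sumr big_seq [leRHS]big_seq; apply: ler_sum => p.
  rewrite mem_primes_in => /and3P[_ lt_p _].
  have : (1000 < p)%N by apply: leq_ltn_trans (leq_trans _ u_ge) lt_p.
  by rewrite -(ltr_nat rat) => lt_p'; apply: double_inv_shift_le.
by move: h; rewrite c_eq; move: (\sum_(p <- _) _) => S; clear; lra.
Qed.

Local Close Scope ring_scope.

Lemma double_count_odd_le u n : 2 * count odd (iota u n) <= n + odd u.
Proof.
elim: n u => [|n IHn] u //=; rewrite mulnDr.
by have := IHn u.+1; rewrite oddS; case: (odd u) => /=; lia.
Qed.

(** Primes above 2 are odd. With at most two roots modulo each prime, this bounds 1 plus the sum of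
    the root counts over a block by the upper end of the block. *)
Lemma double_size_primes_in_lt u v : 1 < u < v ->
  1 + 2 * size (primes_in u v) <= v.
Proof.
case/andP=> u_gt1 uv; have := double_count_odd_le u.+1 (v - u).
suff : size (primes_in u v) <= count odd (iota u.+1 (v - u)).
  by have := leq_b1 (odd u.+1); lia.
rewrite size_filter /index_iota subSS -!size_filter.
apply: uniq_leq_size => [|p]; first by rewrite filter_uniq ?iota_uniq.
rewrite !mem_filter mem_iota => /and3P[p_pr up ->]; rewrite up !andbT.
by case: (even_prime p_pr) => // p2; rewrite p2 ltnS leqNgt u_gt1 in up.
Qed.

(** * Elementary symmetric functions and Bonferroni inequalities *)

Local Open Scope ring_scope.

Fixpoint esym (a : nat -> rat) (l : seq nat) (i : nat) : rat :=
  match l, i with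
  | _, 0%N => 1
  | [::], _.+1 => 0
  | p :: l', j.+1 => esym a l' i + a p * esym a l' j
  end.

Lemma esym0 a l : esym a l 0 = 1. Proof. by case: l. Qed.

Lemma esym1 a l : esym a l 1 = \sum_(p <- l) a p.
Proof.
by elim: l => [|p l IHl]; rewrite ?big_nil // big_cons /= IHl esym0 mulr1 addrC.
Qed.

Lemma esym_ge0 a l i : (forall p, p \in l -> 0 <= a p) -> 0 <= esym a l i.
Proof.
elim: l i => [|p l IHl] [|i] //= a_ge0.
rewrite addr_ge0 ?mulr_ge0 ?a_ge0 ?mem_head //; apply: IHl => q ql;
  by rewrite a_ge0 // inE ql orbT.
Qed.

(** The first two terms of the binomial expansion; for [S = 1] this is Bernoulli's inequality. *)
Lemma exp_add_ge (a S : rat) i : 0 <= a -> 0 <= S ->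
  S ^+ i.+1 + i.+1%:R * (a * S ^+ i) <= (S + a) ^+ i.+1.
Proof.
move=> a_ge0 S_ge0; elim: i => [|i IHi]; first by rewrite mul1r mulr1 addrC addrC.
apply: le_trans (_ : (S + a) * (S ^+ i.+1 + i.+1%:R * (a * S ^+ i)) <= _); last first.
  by rewrite [leRHS]exprS ler_wpM2l // addr_ge0.
have : 0 <= i.+1%:R * a * a * S ^+ i.
  by rewrite !mulr_ge0 ?exprn_ge0 ?ler0n.
rewrite !exprS -[i.+2]addn1 natrD; lra.
Qed.

(** Each product of [i] distinct entries occurs [i!] times in the expansion of the power of the
    sum. *)
Lemma esym_le a l i : (forall p, p \in l -> 0 <= a p) ->
  esym a l i <= (\sum_(p <- l) a p) ^+ i / (i`!)%:R.
Proof.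
elim: l i => [|p l IHl] [|i] a_ge0; rewrite ?esym0 ?expr0 ?divr1 //.
  by rewrite /= big_nil expr0n mul0r.
have al_ge0 q : q \in l -> 0 <= a q by move=> ql; rewrite a_ge0 // inE ql orbT.
have ap_ge0 : 0 <= a p by rewrite a_ge0 ?mem_head.
rewrite big_cons /=; set S := \sum_(q <- l) a q.
have S_ge0 : 0 <= S by rewrite /S big_seq sumr_ge0.
have f_gt0 : 0 < (i`!)%:R :> rat by rewrite ltr0n fact_gt0.
have i_gt0 : 0 < i.+1%:R :> rat by rewrite ltr0n.
apply: (@le_trans _ _ (S ^+ i.+1 / (i.+1`!)%:R + a p * (S ^+ i / (i`!)%:R))).
  by rewrite lerD ?ler_wpM2l ?IHl.
rewrite factS natrM ler_pdivlMr ?mulr_gt0 //.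
apply: le_trans (_ : S ^+ i.+1 + i.+1%:R * (a p * S ^+ i) <= _).
  rewrite le_eqVlt; apply/orP; left; apply/eqP; field.
  by rewrite pnatr_eq0 -lt0n fact_gt0 /= addrC natr1 pnatr_eq0.
by rewrite [a p + _]addrC exp_add_ge.
Qed.

(** The expansion of [\prod_(p <- l) (1 + s * a p)], truncated at degree [b] in [s]. *)
Definition esym_sum (s : rat) (a : nat -> rat) (l : seq nat) (b : nat) : rat :=
  \sum_(i < b.+1) s ^+ i * esym a l i.

Lemma esym_sum0 s a l : esym_sum s a l 0 = 1.
Proof. by rewrite /esym_sum big_ord1 esym0 mulr1. Qed.

Lemma esym_sumS s a l b :
  esym_sum s a l b.+1 = esym_sum s a l b + s ^+ b.+1 * esym a l b.+1.
Proof. by rewrite /esym_sum big_ord_recr. Qed.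

Lemma esym_sum_nil s a b : esym_sum s a [::] b = 1.
Proof. by elim: b => [|b IHb]; rewrite ?esym_sum0 // esym_sumS IHb /= mulr0 addr0. Qed.

Lemma esym_sum_cons s a p l b :
  esym_sum s a (p :: l) b.+1 = esym_sum s a l b.+1 + s * a p * esym_sum s a l b.
Proof.
elim: b => [|b IHb].
  by rewrite !esym_sumS !esym_sum0 /= esym0; ring.
by rewrite esym_sumS {}IHb [in RHS]esym_sumS [esym_sum s a l b.+1]esym_sumS /= !exprS; ring.
Qed.

Lemma esym_sum_full s a l b : (size l <= b)%N ->
  esym_sum s a l b = \prod_(p <- l) (1 + s * a p).
Proof.
elim: l b => [|p l IHl] [|b] // lb; rewrite ?esym_sum_nil ?big_nil //.
by rewrite esym_sum_cons big_cons !IHl ?leqW //; ring.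
Qed.

Lemma esym_sum1_ge0 a l b : (forall p, p \in l -> 0 <= a p) -> 0 <= esym_sum 1 a l b.
Proof.
by move=> a_ge0; apply: sumr_ge0 => i _; rewrite expr1n mul1r esym_ge0.
Qed.

Lemma esym_sum1_le a l b : (forall p, p \in l -> 0 <= a p) ->
  esym_sum 1 a l b <= (1 + \sum_(p <- l) a p) ^+ b.
Proof.
elim: l b => [|p l IHl] [|b] a_ge0; 
  rewrite ?esym_sum0 ?esym_sum_nil ?big_nil ?expr0 ?addr0 ?expr1n //.
have al_ge0 q : q \in l -> 0 <= a q by move=> ql; rewrite a_ge0 // inE ql orbT.
have ap_ge0 : 0 <= a p by rewrite a_ge0 ?mem_head.
rewrite esym_sum_cons mul1r big_cons; set S := \sum_(q <- l) a q.
have S_ge0 : 0 <= S by rewrite /S big_seq sumr_ge0.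
apply: (@le_trans _ _ ((1 + S) ^+ b.+1 + a p * (1 + S) ^+ b)).
  by rewrite lerD ?ler_wpM2l ?IHl.
rewrite exprS -mulrDl exprS [1 + (_ + _)]addrCA [_ + (1 + S)]addrC.
rewrite ler_wpM2l ?addr_ge0 // lerXn2r ?nnegrE ?addr_ge0 //.
by rewrite lerDl.
Qed.

(** The truncation error for [p :: l] at [b + 1] is the error for [l] at [b + 1] minus [a p] times
    the error for [l] at [b]. By induction the latter two have opposite signs, so nothing
    cancels. *)
Lemma bonferroni a l b : (forall p, p \in l -> 0 <= a p <= 1) ->
  0 <= (-1) ^+ b * (esym_sum (-1) a l b - \prod_(p <- l) (1 - a p)).
Proof.
elim: l b => [|p l IHl] b a01.
  by rewrite esym_sum_nil big_nil subrr mulr0.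
have al01 q : q \in l -> 0 <= a q <= 1 by move=> ql; rewrite a01 // inE ql orbT.
have /andP[ap_ge0 ap_le1] : 0 <= a p <= 1 by rewrite a01 ?mem_head.
case: b => [|b].
  rewrite esym_sum0 mul1r subr_ge0 big_seq; apply: prodr_ile1 => q ql.
  by have := a01 q ql; lra.
rewrite esym_sum_cons big_cons; set V := \prod_(q <- l) _.
have := IHl b.+1 al01; have := mulr_ge0 ap_ge0 (IHl b al01).
rewrite -/V exprS; lra.
Qed.

Lemma esym_sum_alt_bounds a l b : (forall p, p \in l -> 0 <= a p <= 1) -> ~~ odd b ->
  \prod_(p <- l) (1 - a p) <= esym_sum (-1) a l b
    <= \prod_(p <- l) (1 - a p) + esym a l b.+1.
Proof.
move=> a01 b_even; have := bonferroni b a01; have := bonferroni b.+1 a01.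
rewrite esym_sumS exprS -signr_odd (negPf b_even) expr0 mulr1 mul1r; lra.
Qed.

(** Since [u <= 1], [u - x <= u (1 - x)]; then Bernoulli and [(1 - x) (1 + x) <= 1]. *)
Lemma exp6_sub_le (u x : rat) : 0 <= x <= u -> u <= 1 ->
  (u - x) ^+ 6 * (1 + 6 * x) <= u ^+ 6.
Proof.
case/andP=> x_ge0 xu u_le1.
have x1 : 1 + 6 * x <= (1 + x) ^+ 6.
  by have := @exp_add_ge x 1 5 x_ge0 ler01; rewrite !expr1n mulr1.
have ux : (u - x) ^+ 6 <= (u * (1 - x)) ^+ 6.
  by rewrite lerXn2r ?nnegrE; nra.
apply: le_trans (_ : (u * (1 - x)) ^+ 6 * (1 + x) ^+ 6 <= _).
  by apply: ler_pM => //; rewrite ?exprn_ge0 ?subr_ge0 //; lra.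
rewrite -exprMn lerXn2r ?nnegrE; nra.
Qed.

(** A rational substitute for the lower bound [exp (- S)], where [S] is the sum of the [h p]: the
    exponential is replaced by [(1 - S / 6) ^ 6]. *)
Lemma prod_one_sub_ge (a h : nat -> rat) l :
  (forall p, p \in l -> 0 <= h p /\ 1 <= (1 + h p) * (1 - a p)) ->
  \sum_(p <- l) h p <= 6 ->
  (1 - (\sum_(p <- l) h p) / 6) ^+ 6 <= \prod_(p <- l) (1 - a p).
Proof.
elim: l => [|p l IHl] hl; first by rewrite !big_nil mul0r subr0 expr1n.
have [hp_ge0 hp_inv] := hl p (mem_head _ _).
have hl' q : q \in l -> 0 <= h q /\ 1 <= (1 + h q) * (1 - a q).
  by move=> ql; apply: hl; rewrite inE ql orbT.
rewrite !big_cons; set S := \sum_(q <- l) h q => leS.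
have S_ge0 : 0 <= S by rewrite /S big_seq sumr_ge0 // => q /hl' [].
have {IHl} := IHl hl'; rewrite -/S => /(_ _) IHl.
have {}IHl : (1 - S / 6) ^+ 6 <= \prod_(q <- l) (1 - a q) by apply: IHl; lra.
have := @exp6_sub_le (1 - S / 6) (h p / 6).
have -> : 1 - S / 6 - h p / 6 = 1 - (h p + S) / 6 by lra.
have -> : 6 * (h p / 6) = h p by lra.
move=> /(_ _ _) h6; have {h6} : (1 - (h p + S) / 6) ^+ 6 * (1 + h p) <= (1 - S / 6) ^+ 6.
  by apply: h6; [apply/andP; split; lra | lra].
have : 0 <= (1 - (h p + S) / 6) ^+ 6 by apply: exprn_ge0; lra.
have a_le1 : 0 <= 1 - a p by rewrite -(pmulr_rge0 _ (_ : 0 < 1 + h p)); lra.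
move: IHl; move: (_ ^+ 6) (_ ^+ 6) (\prod_(q <- l) _) => A B V AB A_ge0 BV.
have := ler_wpM2l a_le1 (le_trans BV AB); have := ler_wpM2l A_ge0 hp_inv; lra.
Qed.

(** * Counting roots modulo squarefree moduli *)

Definition congruence_preserving (f : nat -> nat) : Prop :=
  forall d m, (d %| f (m %% d))%N = (d %| f m)%N.

Definition root_count (f : nat -> nat) (d : nat) : nat := (\sum_(r < d) (d %| f r))%N.

Definition dvdn_ind (f : nat -> nat) m d : rat := (d %| f m)%N%:R.

Lemma root_count1 f : root_count f 1 = 1%N.
Proof. by rewrite /root_count big_ord1 dvd1n. Qed.

(** The Chinese remainder theorem, as a bijection between residues modulo [d * e] and pairs of
    residues. *)
Lemma root_countM f d e : congruence_preserving f -> (0 < d)%N -> (0 < e)%N ->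
  coprime d e -> root_count f (d * e) = (root_count f d * root_count f e)%N.
Proof.
move=> fP d_gt0 e_gt0 co; have de_gt0 : (0 < d * e)%N by rewrite muln_gt0 d_gt0.
pose join (ij : 'I_d * 'I_e) : 'I_(d * e) :=
  Ordinal (ltn_pmod (chinese d e ij.1 ij.2) de_gt0).
pose split (r : 'I_(d * e)) : 'I_d * 'I_e :=
  (Ordinal (ltn_pmod r d_gt0), Ordinal (ltn_pmod r e_gt0)).
have joinK : cancel join split.
  case=> i j; rewrite /join /split /=; congr pair; apply: val_inj => /=.
    by rewrite modn_dvdm ?dvdn_mulr // chinese_modl // modn_small.
  by rewrite modn_dvdm ?dvdn_mull // chinese_modr // modn_small.
have splitK : cancel split join.
  move=> r; apply: val_inj => /=.
  by rewrite -chinese_mod // modn_small.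
rewrite /root_count (reindex join) /=; last by exists split => ? _.
rewrite big_distrl /= -(pair_big xpredT xpredT (fun i j => (d * e %| f (join (i, j)))%N : nat)).
apply: eq_bigr => i _; rewrite big_distrr /=; apply: eq_bigr => j _.
rewrite mulnb Gauss_dvd //; congr (nat_of_bool (_ && _)).
  by rewrite -fP modn_dvdm ?dvdn_mulr // chinese_modl // fP.
by rewrite -fP modn_dvdm ?dvdn_mull // chinese_modr // fP.
Qed.

Lemma sum_period f d q s : congruence_preserving f ->
  (\sum_(m < q * d + s) (d %| f m) = q * root_count f d + \sum_(m < s) (d %| f m))%N.
Proof.
move=> fP; elim: q => [|q IHq]; first by rewrite mul0n.
rewrite mulSn -addnA big_split_ord /= mulSn -addnA -IHq; congr addn.
by apply: eq_bigr => m _; rewrite -fP modnDl fP.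
Qed.

(** Complete periods are counted exactly. The incomplete one has between 0 and [root_count f d]
    roots, and so does its expected share. *)
Lemma count_dvdn_approx f N d : congruence_preserving f -> (0 < d)%N ->
  `|(\sum_(m < N) dvdn_ind f m d) - N%:R * ((root_count f d)%:R / d%:R)|
    <= (root_count f d)%:R :> rat.
Proof.
move=> fP d_gt0; rewrite -natr_sum.
have -> : (\sum_(m < N) (d %| f m) = N %/ d * root_count f d + \sum_(m < N %% d) (d %| f m))%N.
  by rewrite -sum_period // -divn_eq.
have dr_gt0 : 0 < d%:R :> rat by rewrite ltr0n.
have -> : N%:R = (N %/ d)%:R * d%:R + (N %% d)%:R :> rat.
  by rewrite -natrM -natrD -divn_eq.
rewrite natrD natrM.
set q := (N %/ d)%:R; set rho := (root_count f d)%:R; set s := (N %% d)%:R.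
set S := (\sum_(m < N %% d) (d %| f m))%N%:R.
have s_le : s <= d%:R by rewrite ler_nat ltnW // ltn_pmod.
have s_ge0 : 0 <= s by rewrite ler0n.
have rho_ge0 : 0 <= rho by rewrite ler0n.
have S_ge0 : 0 <= S by rewrite ler0n.
have S_le : S <= rho.
  rewrite ler_nat /root_count; have := ltnW (ltn_pmod N d_gt0).
  by move: (N %% d)%N => n /subnKC <-; rewrite big_split_ord leq_addr.
have -> : q * rho + S - (q * d%:R + s) * (rho / d%:R) = S - s * (rho / d%:R).
  by field; rewrite gt_eqF.
have : 0 <= s * (rho / d%:R) <= rho.
  rewrite mulr_ge0 ?divr_ge0 ?ler0n //= mulrA ler_pdivrMr // mulrC.
  by rewrite ler_wpM2l.
by rewrite ler_norml; lra.
Qed.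

(** * Sums of sieve weights: main term and error term *)

(** The weight [h] is built from divisibility by primes of [Q], with mean value [M] and error [E].
    Asking for this on the multiples of every [d] prime to [Q] is what lets further primes be added
    one at a time. *)
Definition sieve_approx f N (Q : seq nat) (h : nat -> rat) (M E : rat) : Prop :=
  forall d, (0 < d)%N -> {in Q, forall q, coprime d q} ->
    `|\sum_(m < N) dvdn_ind f m d * h m
       - N%:R * ((root_count f d)%:R / d%:R) * M| <= (root_count f d)%:R * E.

Lemma sieve_approx_one f N : congruence_preserving f ->
  sieve_approx f N [::] (fun=> 1) 1 1.
Proof.
move=> fP d d_gt0 _; rewrite !mulr1; under eq_bigr do rewrite mulr1.
exact: count_dvdn_approx.
Qed.

Lemma sieve_approx_ext f N Q h1 h2 M E : h1 =1 h2 ->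
  sieve_approx f N Q h1 M E -> sieve_approx f N Q h2 M E.
Proof.
move=> h12 K d d_gt0 dQ; under eq_bigr do rewrite -h12; exact: K.
Qed.

Lemma sieve_approx_sub f N Q Q' h M E : {subset Q <= Q'} ->
  sieve_approx f N Q h M E -> sieve_approx f N Q' h M E.
Proof. by move=> QQ' K d d_gt0 dQ'; apply: K => // q /QQ'; exact: dQ'. Qed.

Lemma sieve_approx_add f N Q h1 h2 M1 M2 E1 E2 :
  sieve_approx f N Q h1 M1 E1 -> sieve_approx f N Q h2 M2 E2 ->
  sieve_approx f N Q (fun m => h1 m + h2 m) (M1 + M2) (E1 + E2).
Proof.
move=> K1 K2 d d_gt0 dQ; under eq_bigr do rewrite mulrDr.
rewrite big_split /= !mulrDr opprD addrACA.
exact: le_trans (ler_normD _ _) (lerD (K1 d d_gt0 dQ) (K2 d d_gt0 dQ)).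
Qed.

Lemma sieve_approx_scale f N Q h M E c :
  sieve_approx f N Q h M E ->
  sieve_approx f N Q (fun m => c * h m) (c * M) (`|c| * E).
Proof.
move=> K d d_gt0 dQ; under eq_bigr do rewrite mulrCA.
rewrite -mulr_sumr mulrCA -mulrBr normrM [leRHS]mulrCA ler_wpM2l //.
exact: K.
Qed.

(** The products that contain [p] form the same kind of sum with [d * p] in place of [d]; the root
    count is multiplicative. *)
Lemma sieve_approx_esym f N Q h M E l i : congruence_preserving f ->
  all prime (l ++ Q) -> uniq (l ++ Q) -> sieve_approx f N Q h M E ->
  sieve_approx f N (l ++ Q) (fun m => esym (dvdn_ind f m) l i * h m)
    (esym (fun p => (root_count f p)%:R / p%:R) l i * M)
    (esym (fun p => (root_count f p)%:R) l i * E).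
Proof.
move=> fP; elim: l i => [|p l IHl] i prl unl K.
  case: i => [|i] d d_gt0 dQ /=; last first.
    by rewrite !(mul0r, mulr0) subr0 big1 ?normr0 // => m _; rewrite mul0r mulr0.
  by under eq_bigr do rewrite mul1r; rewrite !mul1r; exact: K.
have /andP[p_pr prlQ] := prl; have /andP[pN unlQ] := unl.
case: i => [|i].
  apply: (sieve_approx_sub (Q := l ++ Q)); first by move=> q ql; rewrite inE ql orbT.
  have := IHl 0%N prlQ unlQ K; rewrite !esym0.
  by apply: sieve_approx_ext => m; rewrite !esym0.
move=> d d_gt0 dQ /=.
have dp : coprime d p by apply: dQ; rewrite inE eqxx.
have dlQ : {in l ++ Q, forall q, coprime d q} by move=> q ql; apply: dQ; rewrite inE ql orbT.
have p_gt0 := prime_gt0 p_pr.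
have dplQ : {in l ++ Q, forall q, coprime (d * p) q}.
  move=> q ql; have q_pr := allP prlQ q ql.
  rewrite coprimeMl dlQ //= prime_coprime // dvdn_prime2 //.
  by apply: contraNneq pN => ->.
have := IHl i.+1 prlQ unlQ K d d_gt0 dlQ.
have dp_gt0 : (0 < d * p)%N by rewrite muln_gt0 d_gt0.
have := IHl i prlQ unlQ K _ dp_gt0 dplQ.
rewrite !root_countM // !natrM.
set S1 := \sum_(m < N) _; set S2 := \sum_(m < N) _.
have -> : \sum_(m < N) dvdn_ind f m d * ((esym (dvdn_ind f m) l i.+1
    + dvdn_ind f m p * esym (dvdn_ind f m) l i) * h m) = S1 + S2.
  rewrite addrC /S1 /S2 -big_split /=; apply: eq_bigr => m _.
  by rewrite /dvdn_ind Gauss_dvd // -mulnb natrM; ring.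
move: S1 S2 => S1 S2 h1 h2.
have := le_trans (ler_normD _ _) (lerD h1 h2).
set A := `|_|; set B := `|_|; have -> : A = B.
  rewrite /A /B; congr `|_|; rewrite invfM; ring.
by move=> AB; apply: le_trans AB _; rewrite le_eqVlt; apply/orP; left; apply/eqP; ring.
Qed.

Lemma sieve_approx_esym_sum f N Q h M E s l b : congruence_preserving f ->
  `|s| = 1 -> all prime (l ++ Q) -> uniq (l ++ Q) -> sieve_approx f N Q h M E ->
  sieve_approx f N (l ++ Q) (fun m => esym_sum s (dvdn_ind f m) l b * h m)
    (esym_sum s (fun p => (root_count f p)%:R / p%:R) l b * M)
    (esym_sum 1 (fun p => (root_count f p)%:R) l b * E).
Proof.
move=> fP s1 prl unl K; elim: b => [|b IHb].
  rewrite !esym_sum0 !mul1r; apply: (sieve_approx_sub (Q := Q)).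
    by move=> q qQ; rewrite mem_cat qQ orbT.
  by apply: sieve_approx_ext K => m; rewrite esym_sum0 mul1r.
have K2 := sieve_approx_scale (s ^+ b.+1) (sieve_approx_esym b.+1 fP prl unl K).
rewrite normrX s1 expr1n mul1r in K2.
rewrite !esym_sumS !mulrDl expr1n mul1r -mulrA.
by apply: sieve_approx_ext (sieve_approx_add IHb K2) => m; rewrite esym_sumS mulrDl mulrA.
Qed.

(** * The Brun-Hooley sieve *)

Definition sift_level (w i : nat) : nat := (w ^ (2 ^ i))%N.

Lemma sift_levelS w i : sift_level w i.+1 = (sift_level w i ^ 2)%N.
Proof. by rewrite /sift_level expnS mulnC expnM. Qed.

Lemma sift_level_gt1 w i : (1 < w)%N -> (1 < sift_level w i)%N.
Proof.
by move=> w_gt1; elim: i => [|i IHi] //; rewrite sift_levelS expnS expn1; nia.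
Qed.

Definition sift_block (w i : nat) : seq nat :=
  primes_in (sift_level w i) (sift_level w i.+1).

(** Even, so that Bonferroni gives an upper bound. It is 4 in the top block [t - 1] and grows by 2
    with each block further down, where the primes are smaller and long products cost less. *)
Definition truncation (t i : nat) : nat := (2 * (t - i)).+2.

(* The Brun-Hooley weights for the blocks below [s].  With [c = -1] they are
   the sieve weights, or their density when [a] is the local density; with
   [c = 1] they majorise the sum of the absolute values of the coefficients. *)
Fixpoint upper_weight (w t : nat) (c : rat) (a : nat -> rat) (s : nat) : rat :=
  if s is i.+1 then
    esym_sum c a (sift_block w i) (truncation t i) * upper_weight w t c a i
  else esym_sum c a (primes_in 0 w) (size (primes_in 0 w)).

(** For [c = -1], Hooley's lower bound: the product of the upper factors, minus, for each block, its
    first omitted symmetric function times the upper factors of all other blocks. *)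
Fixpoint lower_weight (w t : nat) (c : rat) (a : nat -> rat) (s : nat) : rat :=
  if s is i.+1 then
    esym_sum c a (sift_block w i) (truncation t i) * lower_weight w t c a i
    + c * (esym a (sift_block w i) (truncation t i).+1 * upper_weight w t c a i)
  else upper_weight w t c a 0.

Definition local_density (f : nat -> nat) (p : nat) : rat := (root_count f p)%:R / p%:R.

Lemma all_prime_primes_in u v : all prime (primes_in u v).
Proof. exact: filter_all. Qed.

Lemma uniq_sift_cat u v v' : uniq (primes_in v v' ++ primes_in u v).
Proof.
rewrite cat_uniq !primes_in_uniq andbT; apply/hasPn => p.
by rewrite !mem_primes_in => /and3P[_ _ pv]; rewrite ltnNge pv andbF.
Qed.

Lemma sub_sift_cat v v' : (v <= v')%N ->
  {subset primes_in v v' ++ primes_in 0 v <= primes_in 0 v'}.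
Proof.
move=> vv' p; rewrite mem_cat !mem_primes_in.
by case/orP=> /and3P[-> lt_p le_p] /=; lia.
Qed.

Lemma sift_level_le w i j : (0 < w)%N -> (i <= j)%N -> (sift_level w i <= sift_level w j)%N.
Proof.
move=> w_gt0 ij; rewrite /sift_level; case: w w_gt0 => [|[|w]] // _.
  by rewrite !exp1n.
by rewrite !leq_exp2l.
Qed.

Lemma sieve_approx_esym_primes f N v v' h M E i : congruence_preserving f ->
  (v <= v')%N -> sieve_approx f N (primes_in 0 v) h M E ->
  sieve_approx f N (primes_in 0 v')
    (fun m => esym (dvdn_ind f m) (primes_in v v') i * h m)
    (esym (local_density f) (primes_in v v') i * M)
    (esym (fun p => (root_count f p)%:R) (primes_in v v') i * E).
Proof.
move=> fP vv' K; apply: sieve_approx_sub (sub_sift_cat vv') _.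
by apply: sieve_approx_esym; rewrite ?all_cat ?all_prime_primes_in ?uniq_sift_cat.
Qed.

(** The same recursion, evaluated at the divisibility indicators, the local densities and the root
    counts, yields the weight, its mean value and its error. *)
Lemma sieve_approx_weights f N w t s : congruence_preserving f -> (1 < w)%N ->
  sieve_approx f N (primes_in 0 (sift_level w s))
    (fun m => upper_weight w t (-1) (dvdn_ind f m) s)
    (upper_weight w t (-1) (local_density f) s)
    (upper_weight w t 1 (fun p => (root_count f p)%:R) s) /\
  sieve_approx f N (primes_in 0 (sift_level w s))
    (fun m => lower_weight w t (-1) (dvdn_ind f m) s)
    (lower_weight w t (-1) (local_density f) s)
    (lower_weight w t 1 (fun p => (root_count f p)%:R) s).
Proof.
move=> fP w_gt1; have n1 : `|-1| = 1 :> rat by rewrite normrN1.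
have base : sieve_approx f N (primes_in 0 (sift_level w 0))
    (fun m => upper_weight w t (-1) (dvdn_ind f m) 0)
    (upper_weight w t (-1) (local_density f) 0)
    (upper_weight w t 1 (fun p => (root_count f p)%:R) 0).
  rewrite /sift_level expn0 expn1.
  have := @sieve_approx_esym_sum f N [::] (fun=> 1) 1 1 (-1) (primes_in 0 w)
    (size (primes_in 0 w)) fP n1.
  rewrite cats0 all_prime_primes_in primes_in_uniq !mulr1.
  move=> /(_ isT isT (sieve_approx_one N fP)).
  by apply: sieve_approx_ext => m; rewrite mulr1.
elim: s => [|s [IHY IHH]]; first by split.
have le_s : (sift_level w s <= sift_level w s.+1)%N.
  by rewrite sift_level_le ?(ltnW w_gt1).
have sum_step h M E : sieve_approx f N (primes_in 0 (sift_level w s)) h M E ->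
  sieve_approx f N (primes_in 0 (sift_level w s.+1))
    (fun m => esym_sum (-1) (dvdn_ind f m) (sift_block w s) (truncation t s) * h m)
    (esym_sum (-1) (local_density f) (sift_block w s) (truncation t s) * M)
    (esym_sum 1 (fun p => (root_count f p)%:R) (sift_block w s) (truncation t s) * E).
  move=> K; apply: sieve_approx_sub (sub_sift_cat le_s) _.
  by apply: sieve_approx_esym_sum; rewrite ?all_cat ?all_prime_primes_in ?uniq_sift_cat.
split; first exact: sum_step.
apply: sieve_approx_add; first exact: sum_step.
rewrite -n1; apply: sieve_approx_scale.
exact: sieve_approx_esym_primes.
Qed.

Lemma prod_one_sub_ge0 (a : nat -> rat) l : (forall p, p \in l -> 0 <= a p <= 1) ->
  0 <= \prod_(p <- l) (1 - a p).
Proof. by move=> a01; rewrite big_seq prodr_ge0 // => p /a01; lra. Qed.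

Lemma truncation_even t i : ~~ odd (truncation t i).
Proof. by rewrite /truncation /= negbK mul2n odd_double. Qed.

Section Weights.
Variables (w t : nat) (a : nat -> rat).
Hypothesis a01 : forall p, 0 <= a p <= 1.

Let a_ge0 p : 0 <= a p. Proof. by case/andP: (a01 p). Qed.

Lemma upper_factor_ge0 i : 0 <= esym_sum (-1) a (sift_block w i) (truncation t i).
Proof.
have /andP[h _] := esym_sum_alt_bounds (l := sift_block w i) (fun p _ => a01 p) (truncation_even t i).
by apply: le_trans h; apply: prod_one_sub_ge0.
Qed.

Lemma upper_weight0 : upper_weight w t (-1) a 0 = \prod_(p <- primes_in 0 w) (1 - a p).
Proof. by rewrite /= esym_sum_full //; apply: eq_bigr => p _; rewrite mulN1r. Qed.

Lemma upper_weight_ge0 s : 0 <= upper_weight w t (-1) a s.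
Proof.
elim: s => [|s IHs]; last by rewrite mulr_ge0 ?upper_factor_ge0.
by rewrite upper_weight0 prod_one_sub_ge0.
Qed.

Lemma lower_weight_le s : lower_weight w t (-1) a s <= upper_weight w t (-1) a s.
Proof.
elim: s => [|s IHs] //=; rewrite mulN1r -[leRHS]subr0 lerB //.
  by rewrite ler_wpM2l ?upper_factor_ge0.
by rewrite mulr_ge0 ?upper_weight_ge0 ?esym_ge0.
Qed.

Hypothesis aB : forall p, a p = 0 \/ a p = 1.

Lemma prod_one_sub_bool l : (forall p, p \in l -> a p = 0) \/ \prod_(p <- l) (1 - a p) = 0.
Proof.
elim: l => [|p l [IHl|IHl]]; first by left.
- case: (aB p) => ap; [left => q | right].
    by rewrite inE => /orP[/eqP -> //|/IHl].
  by rewrite big_cons ap subrr mul0r.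
- by right; rewrite big_cons IHl mulr0.
Qed.

Lemma esym_zero l i : (forall p, p \in l -> a p = 0) -> esym a l i.+1 = 0.
Proof.
elim: l i => [|p l IHl] i al //=.
rewrite al ?mem_head // mul0r addr0 IHl // => q ql.
by rewrite al // inE ql orbT.
Qed.

Lemma esym_sum_zero c l b : (forall p, p \in l -> a p = 0) -> esym_sum c a l b = 1.
Proof.
move=> al; elim: b => [|b IHb]; first exact: esym_sum0.
by rewrite esym_sumS IHb esym_zero // mulr0 addr0.
Qed.

(* In a block where some [a p = 1], Bonferroni bounds the factor of the block by
   the symmetric function that [lower_weight] subtracts. *)
Lemma lower_weight_bool s :
  (forall p, p \in primes_in 0 (sift_level w s) -> a p = 0) /\
    lower_weight w t (-1) a s = 1 /\ upper_weight w t (-1) a s = 1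
  \/ lower_weight w t (-1) a s <= 0.
Proof.
elim: s => [|s IHs].
  have := prod_one_sub_bool (primes_in 0 w); rewrite [lower_weight _ _ _ _ _]upper_weight0 upper_weight0.
  case=> [al|->]; last by right.
  left; rewrite big_seq big1; last by move=> p /al ->; rewrite subr0.
  by rewrite /sift_level expn1.
have [al|a0] := prod_one_sub_bool (sift_block w s).
  rewrite /= esym_zero // esym_sum_zero // !mul1r mul0r mulr0 addr0.
  case: IHs => [[bl [-> ->]]|]; [left | by right].
  split=> // p; rewrite mem_primes_in => /and3P[p_pr p_gt0 ps].
  have [ps'|ps'] := leqP p (sift_level w s).
    by apply: bl; rewrite mem_primes_in p_pr p_gt0.
  by apply: al; rewrite mem_primes_in p_pr ps'.
right; have /andP[_] := esym_sum_alt_bounds (l := sift_block w s) (fun p _ => a01 p)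
  (truncation_even t s).
rewrite a0 add0r => le_e; rewrite /= mulN1r subr_le0.
apply: le_trans (_ : esym_sum (-1) a (sift_block w s) (truncation t s) * upper_weight w t (-1) a s <= _).
  by rewrite ler_wpM2l ?upper_factor_ge0 ?lower_weight_le.
by rewrite ler_wpM2r ?upper_weight_ge0.
Qed.

End Weights.

(** * Bounds for the main term and the error term *)

Lemma ler_exp2r (x y : rat) n : 0 <= x -> x <= y -> x ^+ n <= y ^+ n.
Proof. by move=> x_ge0 xy; rewrite lerXn2r ?nnegrE // (le_trans x_ge0). Qed.

(** At the start [(3/2)^5 / 5! < 1/15]; raising the exponent from [n >= 5] to [n + 2] multiplies by
    at most [S^2 / 42 < 1/10]. *)
Lemma exp_fact_le (S : rat) j : 0 <= S <= 3 / 2 ->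
  S ^+ (2 * j + 5) / ((2 * j + 5)`!)%:R <= 1 / 15 * (1 / 10) ^+ j.
Proof.
case/andP=> S_ge0 S_le; elim: j => [|j IHj].
  rewrite muln0 add0n expr0 mulr1 ler_pdivrMr; last by rewrite ltr0n fact_gt0.
  have -> : 5`! = 120%N by [].
  apply: le_trans (ler_exp2r 5 S_ge0 S_le) _.
  by rewrite !exprS expr0; clear; lra.
have -> : (2 * j.+1 + 5 = (2 * j + 5).+2)%N by lia.
move: IHj; have : (5 <= 2 * j + 5)%N by lia.
move: (2 * j + 5)%N => n n_ge5; set A := S ^+ n / _ => IHj.
have A_ge0 : 0 <= A by rewrite divr_ge0 ?exprn_ge0 ?ler0n.
have n5 : 5%:R <= n%:R :> rat by rewrite ler_nat.
have nf_gt0 : 0 < (n`!)%:R :> rat by rewrite ltr0n fact_gt0.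
have -> : S ^+ n.+2 / (n.+2`!)%:R = A * (S * S / ((n%:R + 2) * (n%:R + 1))).
  rewrite /A !factS !natrM !exprS -[n.+2]addn2 -[n.+1]addn1 !natrD; field.
  by rewrite (gt_eqF nf_gt0) !lt0r_neq0 //; lra.
have S2 : S * S / ((n%:R + 2) * (n%:R + 1)) <= 1 / 10.
  rewrite ler_pdivrMr; last by apply: mulr_gt0; lra.
  nra.
have S2_ge0 : 0 <= S * S / ((n%:R + 2) * (n%:R + 1)).
  by rewrite divr_ge0 ?mulr_ge0 //; lra.
by rewrite exprSr [leRHS]mulrA; apply: ler_pM.
Qed.

Section WeightBounds.
Variables (w t : nat).
Hypothesis w_gt2 : (2 < w)%N.

Let level_gt2 i : (2 < sift_level w i)%N.
Proof.
by have := sift_level_le (ltnW (ltnW w_gt2)) (leq0n i); rewrite {1}/sift_level expn1; apply: leq_trans.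
Qed.

Lemma mem_sift_block_gt2 i p : p \in sift_block w i -> 2 < p%:R :> rat.
Proof.
by rewrite mem_primes_in => /and3P[_ lt_p _]; rewrite ltr_nat (ltn_trans (level_gt2 i)).
Qed.

Section MainTerm.
Variable g : nat -> rat.
Hypothesis g01 : forall p, 0 <= g p <= 1.
Hypothesis g_le : forall p, prime p -> g p <= 2 / p%:R.
Hypothesis g_lt1 : forall p, prime p -> g p < 1.
Hypothesis block_le : forall i, \sum_(p <- sift_block w i) 2 / (p%:R - 2) <= 3 / 2 :> rat.

Let g_ge0 p : 0 <= g p. Proof. by case/andP: (g01 p). Qed.

Lemma sum_block_le i : \sum_(p <- sift_block w i) g p <= 3 / 2.
Proof.
apply: le_trans (block_le i); rewrite big_seq [leRHS]big_seq; apply: ler_sum => p p_in.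
have p_gt2 := mem_sift_block_gt2 p_in.
move: p_in; rewrite mem_primes_in => /and3P[p_pr _ _].
apply: le_trans (g_le p_pr) _.
by rewrite ler_pM2l // lef_pV2 ?posrE; lra.
Qed.

Lemma upper_factor_ge i : 1 / 6 <= esym_sum (-1) g (sift_block w i) (truncation t i).
Proof.
have /andP[h _] := esym_sum_alt_bounds (l := sift_block w i) (fun p _ => g01 p) (truncation_even t i).
apply: le_trans h.
apply: le_trans (prod_one_sub_ge (h := fun p => 2 / (p%:R - 2)) _ _); last first.
- by have := block_le i; lra.
- move=> p p_in; have p_gt2 := mem_sift_block_gt2 p_in.
  move: p_in; rewrite mem_primes_in => /and3P[p_pr _ _].
  have p2_gt0 : 0 < p%:R - 2 :> rat by lra.
  split; first by rewrite divr_ge0 // ltW.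
  have -> : 1 + 2 / (p%:R - 2) = p%:R / (p%:R - 2) :> rat by field; rewrite gt_eqF.
  rewrite mulrAC ler_pdivlMr // mul1r.
  have := g_le p_pr; rewrite ler_pdivlMr; lra.
have S_le := block_le i.
(* With block sums at most 3/2, the bound is [(1 - 1/4) ^ 6], slightly more than 1/6. *)
apply: le_trans (_ : (3 / 4) ^+ 6 <= _); first by rewrite !exprS expr0; lra.
by apply: ler_exp2r; move: S_le; move: (\sum_(p <- _) _) => S; lra.
Qed.

(** Since [1/15 = 2/5 * 1/6] and the factor of the block is at least 1/6, the omitted term is small
    relative to that factor. *)
Lemma esym_block_le i : (i < t)%N ->
  esym g (sift_block w i) (truncation t i).+1
    <= 2 / 5 * (1 / 10) ^+ (t - i.+1) * esym_sum (-1) g (sift_block w i) (truncation t i).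
Proof.
move=> lt_it; have le6 := upper_factor_ge i.
apply: le_trans (_ : 1 / 15 * (1 / 10) ^+ (t - i.+1) <= _); last first.
  have e_ge0 : 0 <= (1 / 10 : rat) ^+ (t - i.+1) by apply: exprn_ge0; lra.
  by move: le6 e_ge0; move: (esym_sum _ _ _ _) (_ ^+ _) => U e; nra.
apply: le_trans (esym_le _ (fun p _ => g_ge0 p)) _.
have -> : (truncation t i).+1 = (2 * (t - i.+1) + 5)%N by rewrite /truncation; lia.
by apply: exp_fact_le; rewrite sumr_ge0 // sum_block_le.
Qed.

(** A loss of [6 ^ s] is affordable, because [sift_level w s] grows doubly exponentially in [s]. *)
Lemma upper_weight_ge s :
  \prod_(p <- primes_in 0 w) (1 - g p) * (1 / 6) ^+ s <= upper_weight w t (-1) g s.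
Proof.
have V_ge0 : 0 <= \prod_(p <- primes_in 0 w) (1 - g p) by apply: prod_one_sub_ge0.
elim: s => [|s IHs]; first by rewrite upper_weight0 expr0 mulr1.
rewrite exprS mulrCA /=; apply: ler_pM (upper_factor_ge s) IHs; first by lra.
by apply: mulr_ge0 V_ge0 _; apply: exprn_ge0; lra.
Qed.

Lemma prod_small_gt0 : 0 < \prod_(p <- primes_in 0 w) (1 - g p).
Proof.
rewrite big_seq prodr_gt0 // => p; rewrite mem_primes_in => /and3P[p_pr _ _].
by rewrite subr_gt0 g_lt1.
Qed.

(* The loss of block [i] is at most (2/5) 10^(i+1-t), and these sum to 4/9. *)
Lemma lower_weight_ge s : (s <= t)%N ->
  upper_weight w t (-1) g s * (1 - 4 / 9 * (1 / 10) ^+ (t - s))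
    <= lower_weight w t (-1) g s.
Proof.
elim: s => [|s IHs] le_st.
  have e_ge0 : 0 <= (1 / 10 : rat) ^+ (t - 0) by apply: exprn_ge0; lra.
  have Y_ge0 := upper_weight_ge0 w t g01 0.
  change (lower_weight w t (-1) g 0) with (upper_weight w t (-1) g 0).
  move: Y_ge0 e_ge0; move: (upper_weight _ _ _ _ _) (_ ^+ _) => Y e Y_ge0 e_ge0.
  by have := mulr_ge0 Y_ge0 e_ge0; lra.
have := IHs (ltnW le_st); have := esym_block_le le_st.
(* The constant reproduces itself: [4/9 * 1/10 + 2/5 = 4/9]. *)
have -> : (t - s = (t - s.+1).+1)%N by lia.
have Y_ge0 := upper_weight_ge0 w t g01 s; have := upper_factor_ge0 w t g01 s.
rewrite /= exprS; set e := (_ ^+ _); move: Y_ge0.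
move: (esym_sum _ _ _ _) (esym _ _ _) (upper_weight _ _ _ _ _) (lower_weight _ _ _ _ _).
move=> U T Y H Y_ge0 U_ge0 leT leH.
have h1 := ler_wpM2l Y_ge0 leT; have h2 := ler_wpM2l U_ge0 leH.
lra.
Qed.

End MainTerm.

Section ErrorTerm.
Variable r : nat -> rat.
Hypothesis r_ge0 : forall p, 0 <= r p.
Hypothesis r_le2 : forall p, prime p -> r p <= 2.

Lemma sum_primes_in_le u v : (1 < u < v)%N -> 1 + \sum_(p <- primes_in u v) r p <= v%:R.
Proof.
move=> uv; apply: le_trans (_ : (1 + 2 * size (primes_in u v))%N%:R <= _); last first.
  by rewrite ler_nat double_size_primes_in_lt.
rewrite natrD lerD2l.
have -> : (2 * size (primes_in u v))%N%:R = \sum_(p <- primes_in u v) 2 :> rat.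
  by rewrite big_const_seq count_predT iter_addr_0 natrM mulr_natr.
rewrite big_seq [leRHS]big_seq; apply: ler_sum => p.
by rewrite mem_primes_in => /and3P[p_pr _ _]; apply: r_le2.
Qed.

Let level_lt i : (1 < sift_level w i < sift_level w i.+1)%N.
Proof.
have h := level_gt2 i; rewrite ltnW // sift_levelS expnS expn1; nia.
Qed.

Lemma esym_sum_block_le i b :
  0 <= esym_sum 1 r (sift_block w i) b <= (sift_level w i.+1)%:R ^+ b.
Proof.
rewrite esym_sum1_ge0 //=; apply: le_trans (esym_sum1_le _ _) _ => //.
have h := sum_primes_in_le (level_lt i).
rewrite lerXn2r ?nnegrE ?ler0n // addr_ge0 ?sumr_ge0 //.
Qed.

Lemma esym_block_error_le i b :
  0 <= esym r (sift_block w i) b.+1 <= (sift_level w i.+1)%:R ^+ b.+1.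
Proof.
rewrite esym_ge0 //=; have /andP[_ h] := esym_sum_block_le i b.+1.
apply: le_trans h; rewrite esym_sumS expr1n mul1r lerDr.
exact: esym_sum1_ge0.
Qed.

Let E0 := upper_weight w t 1 r 0.

(* The exponent 4 (t - s) + 12 is the level 2^(1-s) * \sum_(i < s) 2^i (2 (t - i) + 2)
   of the weight, majorised so that the induction closes exactly. *)
Lemma weight_error_le s : (s <= t)%N ->
  0 <= upper_weight w t 1 r s <= E0 * (sift_level w s)%:R ^+ (4 * (t - s) + 12) /\
  0 <= lower_weight w t 1 r s <= 2 * E0 * (sift_level w s)%:R ^+ (4 * (t - s) + 13).
Proof.
have E0_ge0 : 0 <= E0 by rewrite /E0 /= esym_sum1_ge0.
elim: s => [|s IHs] le_st.
  have z_ge1 : 1 <= (sift_level w 0)%:R :> rat by rewrite ler1n (ltn_trans _ (level_gt2 0)).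
  rewrite /= -/(upper_weight w t 1 r 0) -/E0 E0_ge0 /=; split.
    by rewrite ler_peMr // exprn_ege1.
  have := exprn_ege1 (4 * (t - 0) + 13) z_ge1; move: (_ ^+ _) => x; nra.
have [/andP[Y_ge0 leY] /andP[H_ge0 leH]] := IHs (ltnW le_st).
have -> : (4 * (t - s.+1) + 13 = (4 * (t - s.+1) + 12).+1)%N by lia.
have e1 : (4 * (t - s) + 12 = 2 * (2 * (t - s) + 6))%N by lia.
have e2 : (4 * (t - s) + 13 = (2 * (2 * (t - s) + 6)).+1)%N by lia.
have e3 : (4 * (t - s.+1) + 12 = truncation t s + (2 * (t - s) + 6))%N.
  by rewrite /truncation; lia.
rewrite e1 in leY; rewrite e2 in leH; rewrite e3.
have zS : (sift_level w s)%:R ^+ 2 = (sift_level w s.+1)%:R :> rat.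
  by rewrite sift_levelS natrX.
rewrite exprM zS in leY; rewrite exprS exprM zS in leH.
have /andP[U_ge0 leU] := esym_sum_block_le s (truncation t s).
have /andP[T_ge0 leT] := esym_block_error_le s (truncation t s).
rewrite exprS exprD /= mul1r.
have z_ge2 : 2 <= (sift_level w s)%:R :> rat by rewrite ler_nat ltnW // level_gt2.
(* The odd exponent in the bound for the lower weight leaves one factor that is not squared. Its
   double is at most the next level, which makes room for the added term. *)
have zz : 2 * (sift_level w s)%:R <= (sift_level w s.+1)%:R :> rat.
  by rewrite -zS expr2 ler_wpM2r // ler0n.
rewrite exprS in leT; move: leU leT leY leH zz; set Z := (sift_level w s.+1)%:R.
have B_ge0 : 0 <= Z ^+ truncation t s by rewrite exprn_ge0 ?ler0n.
have C_ge0 : 0 <= Z ^+ (2 * (t - s) + 6) by rewrite exprn_ge0 ?ler0n.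
have Z_ge0 : 0 <= Z by rewrite ler0n.
move: U_ge0 T_ge0 Y_ge0 H_ge0 B_ge0 C_ge0.
move: (esym_sum _ _ _ _) (esym _ _ _) (upper_weight _ _ _ _ s) (lower_weight _ _ _ _ _).
move: (_ ^+ _) (_ ^+ _) => B C.
move=> U T Y H U_ge0 T_ge0 Y_ge0 H_ge0 B_ge0 C_ge0 leU leT leY leH zz.
split; apply/andP; split.
- exact: mulr_ge0.
- by apply: le_trans (ler_pM _ _ leU leY) _ => //; rewrite le_eqVlt; apply/orP; left; apply/eqP; ring.
- by rewrite addr_ge0 ?mulr_ge0.
apply: le_trans (lerD (ler_pM U_ge0 H_ge0 leU leH) (ler_pM T_ge0 Y_ge0 leT leY)) _.
have P_ge0 : 0 <= B * (E0 * C) by rewrite !mulr_ge0.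
have := ler_wpM2l P_ge0 zz; lra.
Qed.

End ErrorTerm.
End WeightBounds.

(** * The lower bound sieve with Kuhn weights *)

Lemma root_count_le f d : (root_count f d <= d)%N.
Proof.
rewrite /root_count -[X in (_ <= X)%N]card_ord -sum1_card.
by apply: leq_sum => r _; apply: leq_b1.
Qed.

Lemma local_density01 f p : 0 <= local_density f p <= 1.
Proof.
rewrite /local_density divr_ge0 ?ler0n //=; case: p => [|p]; first by rewrite mulr0n invr0 mulr0.
by rewrite ler_pdivrMr ?ltr0n // mul1r ler_nat root_count_le.
Qed.

Lemma dvdn_ind01 f m p : 0 <= dvdn_ind f m p <= 1.
Proof. by rewrite /dvdn_ind; case: (_ %| _)%N; rewrite ?lexx ?ler01. Qed.

Lemma dvdn_ind_bool f m p : dvdn_ind f m p = 0 \/ dvdn_ind f m p = 1.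
Proof. by rewrite /dvdn_ind; case: (_ %| _)%N; [right | left]. Qed.

Lemma sift_level3 w t : sift_level w (t + 3) = (sift_level w t ^ 8)%N.
Proof. by rewrite addn3 !sift_levelS -!expnM. Qed.

Lemma primes_in_sift_level3 w t : (0 < w)%N ->
  primes_in (sift_level w t) (sift_level w (t + 3)) =
  sift_block w t ++ sift_block w t.+1 ++ sift_block w t.+2.
Proof.
move=> w_gt0; rewrite addn3 /sift_block.
rewrite (@primes_in_cat _ (sift_level w t.+1)); last first.
  by rewrite !sift_level_le // ltnS ltnW.
rewrite (@primes_in_cat (sift_level w t.+1) (sift_level w t.+2)) //.
by rewrite !sift_level_le.
Qed.

Definition sifted (f : nat -> nat) (z y m : nat) : bool :=
  all (fun p => ~~ (p %| f m)%N) (primes_in 0 z) &&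
  (count (fun p => (p %| f m)%N) (primes_in z y) < 10)%N.

Lemma sum_dvdn_ind f m l :
  \sum_(p <- l) dvdn_ind f m p = (count (fun p => (p %| f m)%N) l)%:R.
Proof.
rewrite -sum1_count natr_sum [RHS]big_mkcond /=; apply: eq_bigr => p _.
by rewrite /dvdn_ind; case: (_ %| _)%N.
Qed.

(** If no prime up to [z] divides [f m], both weights are 1 and the left side is [1 - c / 10], with
    [c] the number of primes in [(z, y]] dividing [f m]. Otherwise both terms are at most 0. *)
Lemma sieve_weight_le f w t z y m : z = sift_level w t ->
  lower_weight w t (-1) (dvdn_ind f m) t
    + (- (1 / 10)) * (esym (dvdn_ind f m) (primes_in z y) 1
                     * upper_weight w t (-1) (dvdn_ind f m) t)
  <= (sifted f z y m)%:R.
Proof.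
move=> ->; have a01 := dvdn_ind01 f m; have aB := dvdn_ind_bool f m.
rewrite esym1 sum_dvdn_ind; set c := count _ _.
have c_ge0 : 0 <= c%:R :> rat by rewrite ler0n.
have Y_ge0 := upper_weight_ge0 w t a01 t.
case: (lower_weight_bool w t a01 aB t) => [[al [-> ->]]|H_le0].
  have -> : sifted f (sift_level w t) y m = (c < 10)%N.
    rewrite /sifted -/c.
    suff -> : all (fun p => ~~ (p %| f m)%N) (primes_in 0 (sift_level w t)) by [].
    apply/allP => p /al /eqP; rewrite /dvdn_ind.
    by case: (_ %| _)%N.
  have [_|c_ge] := ltnP c 10.
    by rewrite mulr1 /= mulr1n; move: c_ge0; set x := c%:R; lra.
  have : 10%:R <= c%:R :> rat by rewrite ler_nat.
  rewrite mulr1 /= mulr0n; set x := c%:R; lra.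
apply: (@le_trans _ _ 0); last by rewrite ler0n.
by have := mulr_ge0 c_ge0 Y_ge0; lra.
Qed.

Lemma sifted_count f w t N : congruence_preserving f -> (2 < w)%N ->
  (forall i, \sum_(p <- sift_block w i) 2 / (p%:R - 2) <= 3 / 2 :> rat) ->
  (forall p, prime p -> (root_count f p <= 2)%N /\ (root_count f p < p)%N) ->
  forall z V E, z = sift_level w t ->
  V = \prod_(p <- primes_in 0 w) (1 - local_density f p) ->
  E = upper_weight w 0 1 (fun p => (root_count f p)%:R) 0 ->
  N%:R * (V * (1 / 6) ^+ t / 10) - 3 * E * z%:R ^+ 20
    <= (\sum_(m < N) sifted f z (z ^ 8) m)%N%:R :> rat.
Proof.
move=> fP w_gt2 blockP rootP z V E zE VE EE; have w_gt0 : (0 < w)%N by apply: leq_trans w_gt2.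
have z_gt1 : (1 < z)%N by rewrite zE sift_level_gt1 // ltnW.
have zy : (z <= z ^ 8)%N.
  by rewrite -{1}[z]expn1 leq_pexp2l // zE expn_gt0 w_gt0.
have [KY KH] := sieve_approx_weights N t t fP (ltnW w_gt2); rewrite -zE in KY KH.
have KP := sieve_approx_scale (- (1 / 10)) (sieve_approx_esym_primes 1 fP zy KY).
have subzy : {subset primes_in 0 z <= primes_in 0 (z ^ 8)}.
  by move=> p; rewrite !mem_primes_in => /and3P[-> -> /= pz]; apply: leq_trans zy.
have := sieve_approx_add (sieve_approx_sub subzy KH) KP.
move=> /(_ 1%N isT (fun q _ => coprime1n q)).
rewrite root_count1 divr1 mul1r.
set S := \sum_(m < N) _; set M := lower_weight _ _ _ (local_density f) _ + _.
set Er := lower_weight _ _ _ _ _ + _ => approx.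
have S_le : S <= (\sum_(m < N) sifted f z (z ^ 8) m)%N%:R.
  rewrite natr_sum; apply: ler_sum => m _; rewrite /dvdn_ind dvd1n mul1r.
  exact: sieve_weight_le.
apply: le_trans S_le.
have g_le p : prime p -> local_density f p <= 2 / p%:R.
  move=> p_pr; have [le2 _] := rootP p p_pr.
  by rewrite ler_wpM2r ?invr_ge0 ?ler0n // ler_nat.
have g_lt1 p : prime p -> local_density f p < 1.
  move=> p_pr; have [_ lt_p] := rootP p p_pr.
  by rewrite ltr_pdivrMr ?ltr0n ?prime_gt0 // mul1r ltr_nat.
have g01 := local_density01 f.
have r_ge0 p : 0 <= (root_count f p)%:R :> rat by rewrite ler0n.
have r_le2 p : prime p -> (root_count f p)%:R <= 2 :> rat.
  by move=> p_pr; rewrite ler_nat; have [] := rootP p p_pr.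
(* The range [(z, z ^ 8]] consists of three blocks, each with sum at most 3/2. *)
have sum_g : esym (local_density f) (primes_in z (z ^ 8)) 1 <= 9 / 2.
  rewrite esym1 zE -sift_level3 primes_in_sift_level3 // !big_cat /=.
  have h i := sum_block_le w_gt2 g_le blockP i.
  have := h t; have := h t.+1; have := h t.+2.
  by move: (\sum_(p <- _) _) (\sum_(p <- _) _) (\sum_(p <- _) _) => a b c; lra.
have sum_g_ge0 : 0 <= esym (local_density f) (primes_in z (z ^ 8)) 1.
  by apply: esym_ge0 => p _; case/andP: (g01 p).
have sum_r : 0 <= esym (fun p => (root_count f p)%:R) (primes_in z (z ^ 8)) 1 <= z%:R ^+ 8.
  rewrite esym_ge0 //= esym1.
  have zz : (1 < z < z ^ 8)%N.
    by rewrite z_gt1 /= -{1}[z]expn1 ltn_exp2l.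
  by have := sum_primes_in_le r_le2 zz; rewrite natrX; move: (\sum_(p <- _) _) (_ ^+ _) => a b; lra.
have [Yerr Herr] := weight_error_le w_gt2 r_ge0 r_le2 (leqnn t).
have := @upper_weight_ge w t w_gt2 (local_density f) g01 g_le blockP t.
have := lower_weight_ge w_gt2 g01 g_le blockP (leqnn t).
have z_ge1 : 1 <= z%:R :> rat by rewrite ler1n ltnW.
rewrite -zE subnn muln0 add0n in Yerr Herr.
rewrite subnn expr0 -VE => leH leY.
(* The sieve keeps 5/9 of the upper weight and the Kuhn term takes at most [1/10 * 9/2]; the
   difference 19/180 exceeds 1/10. *)
have leM : V * (1 / 6) ^+ t / 10 <= M.
  have V_ge0 : 0 <= V * (1 / 6) ^+ t.
    by apply: mulr_ge0; [rewrite VE; apply: prod_one_sub_ge0 | apply: exprn_ge0; lra].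
  rewrite /M; move: leH leY sum_g sum_g_ge0 V_ge0.
  move: (V * _) (lower_weight _ _ _ _ _) (upper_weight _ _ _ _ _) (esym _ _ _).
  clear; move=> v H Y s leH leY s_le s_ge0 v_ge0.
  have Y_ge0 : 0 <= Y by apply: le_trans leY.
  have := ler_wpM2r Y_ge0 s_le; lra.
(* The lower weight contributes [2 E z^13], the Kuhn term at most [E z^8 z^12 / 10]. *)
have leE : Er <= 3 * E * z%:R ^+ 20.
  (* At level 0 the weight does not depend on [t], so [E] is known before [t] is chosen. *)
  have E_eq : upper_weight w t 1 (fun p => (root_count f p)%:R) 0 = E by rewrite EE.
  rewrite [upper_weight w t 1 _ 0]E_eq in Yerr Herr; rewrite /Er.
  have E_ge0 : 0 <= E by rewrite EE /=; apply: esym_sum1_ge0.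
  have z13 : z%:R ^+ 13 <= z%:R ^+ 20 :> rat by apply: ler_weXn2l.
  have n10 : `|- (1 / 10)| = 1 / 10 :> rat by rewrite normrN; apply: ger0_norm; lra.
  have e20 : z%:R ^+ 20 = z%:R ^+ 8 * z%:R ^+ 12 :> rat by rewrite -exprD.
  rewrite n10; move: Yerr Herr sum_r z13 e20 E_ge0.
  have : 0 <= z%:R ^+ 20 :> rat by rewrite exprn_ge0 ?ler0n.
  move: (lower_weight _ _ _ _ _) (upper_weight _ _ _ _ _) (esym _ _ _).
  move: (_ ^+ 20) (_ ^+ 13) (_ ^+ 8) (_ ^+ 12) => z20 z13 z8 z12.
  clear; move=> H Y r z20_ge0 /andP[Y_ge0 leY] /andP[H_ge0 leH] /andP[r_ge0 ler] le13 eq20 E_ge0.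
  have h1 := ler_pM r_ge0 Y_ge0 ler leY.
  have h2 := ler_wpM2l E_ge0 le13.
  have h3 := mulr_ge0 E_ge0 z20_ge0.
  have -> : 3 * E * z20 = 2 * (E * z20) + z8 * (E * z12) by rewrite eq20; ring.
  have : z8 * (E * z12) = E * z20 by rewrite eq20; ring.
  move: h1 h2 h3 leH; lra.
have N_ge0 : 0 <= N%:R :> rat by rewrite ler0n.
have := ler_wpM2l N_ge0 leM; move: approx; rewrite ler_norml => /andP[+ _].
move: leE; clear; move: (_ * M) (_ * (V * _ / _)) (3 * E * _) => a b c; lra.
Qed.

Local Close Scope ring_scope.

(** * Values of m (2 m + k) with few prime factors *)

Lemma exists_prime_list n : 0 < n -> exists2 s, all prime s & \prod_(p <- s) p = n.
Proof.
elim/ltn_ind: n => n IHn n_gt0; have [n_le1|n_gt1] := leqP n 1.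
  by exists [::]; rewrite ?big_nil //; lia.
have p_pr := pdiv_prime n_gt1; have pn := pdiv_dvd n.
have q_gt0 : 0 < n %/ pdiv n by rewrite divn_gt0 ?pdiv_gt0 // dvdn_leq.
have [s prs sE] := IHn _ (ltn_Pdiv (prime_gt1 p_pr) n_gt0) q_gt0.
by exists (pdiv n :: s); rewrite /= ?p_pr // big_cons sE mulnC divnK.
Qed.

Lemma dvdn_prod_mem (s : seq nat) p : p \in s -> p %| \prod_(q <- s) q.
Proof. by move=> ps; rewrite (big_rem p) //= dvdn_mulr. Qed.

Lemma exp_count_dvdn (s : seq nat) p : p ^ count_mem p s %| \prod_(q <- s) q.
Proof.
elim: s => [|q s IHs]; first by rewrite big_nil.
rewrite big_cons /= expnD dvdn_mul //; case: eqP => [->|_]; first by rewrite expn1.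
exact: dvd1n.
Qed.

(** This turns a bound on the number of distinct primes, which the sieve gives, into one that counts
    multiplicity. *)
Lemma uniq_filter_squarefree (s : seq nat) (P : pred nat) :
  (forall p, P p -> p \in s -> ~~ (p ^ 2 %| \prod_(q <- s) q)) -> uniq (filter P s).
Proof.
move=> sqf; apply: count_mem_uniq => p; rewrite count_filter.
have [Pps|] := boolP (p \in filter P s); last first.
  move/count_memPn; rewrite count_filter => ->; exact.
have /andP[Pp ps] : P p && (p \in s) by rewrite -mem_filter.
have -> : count (predI (pred1 p) P) s = count_mem p s.
  by apply: eq_count => q /=; case: eqP => [->|].
apply/eqP; rewrite eqn_leq -has_count has_pred1 ps andbT leqNgt.
apply: contra (sqf p Pp ps) => lt1.
exact: dvdn_trans (dvdn_exp2l p lt1) (exp_count_dvdn s p).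
Qed.

Lemma exp_count_le (s : seq nat) y : all prime s ->
  y ^ count (fun p => y < p) s <= \prod_(p <- s) p.
Proof.
elim: s => [|p s IHs]; first by rewrite big_nil.
case/andP=> p_pr prs; rewrite big_cons /= expnD leq_mul ?IHs //.
by case: ltnP => [/ltnW|_]; rewrite ?expn1 ?expn0 ?prime_gt0.
Qed.

Lemma count_large_le2 (s : seq nat) z : all prime s -> 1 < z ->
  \prod_(p <- s) p < z ^ 24 -> count (fun p => z ^ 8 < p) s <= 2.
Proof.
move=> prs z_gt1 lt_s; rewrite leqNgt; apply/negP => c3.
have := leq_ltn_trans (exp_count_le (z ^ 8) prs) lt_s.
by rewrite -expnM ltn_exp2l //; lia.
Qed.

Definition pair_form (k m : nat) : nat := m * (2 * m + k).

Lemma linear_congruence_preserving a b : congruence_preserving (fun m => a * m + b).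
Proof. by move=> d m; rewrite /dvdn -modnDml modnMmr modnDml. Qed.

Lemma id_congruence_preserving : congruence_preserving id.
Proof. by move=> d m; rewrite /dvdn modn_mod. Qed.

Lemma pair_form_congruence_preserving k : congruence_preserving (pair_form k).
Proof.
move=> d m; have lin : 2 * (m %% d) + k = 2 * m + k %[mod d].
  by rewrite -modnDml modnMmr modnDml.
by rewrite /dvdn /pair_form modnMml -modnMmr lin modnMmr.
Qed.

Lemma sum_bool_card (I : finType) (P : pred I) : \sum_(i : I) (P i : nat) = #|P|.
Proof.
rewrite -sum1_card [RHS]big_mkcond; apply: eq_bigr => i _.
by rewrite unfold_in; case: (P i).
Qed.

Lemma root_count_le1 f d :
  (forall r s, r < s -> s < d -> d %| f r -> d %| f s -> False) ->
  root_count f d <= 1.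
Proof.
move=> inj; rewrite /root_count sum_bool_card.
apply/card_le1_eqP => r s; rewrite !unfold_in => dr ds; apply: val_inj => /=.
case: (ltngtP r s) => // lt; first by case: (inj r s).
by case: (inj s r).
Qed.

Lemma root_count_id d : root_count id d <= 1.
Proof.
apply: root_count_le1 => r s lt_rs lt_sd _ /dvdn_leq.
by case: s lt_rs lt_sd => // s _ lt_sd /(_ isT); rewrite leqNgt lt_sd.
Qed.

Lemma root_count_linear d k : coprime d 2 -> root_count (fun m => 2 * m + k) d <= 1.
Proof.
move=> d_odd; apply: root_count_le1 => r s lt_rs lt_sd dr ds.
have : d %| 2 * (s - r) by rewrite mulnBr -(dvdn_addr _ dr) addnAC subnKC // leq_mul2l /= ltnW.
by rewrite Gauss_dvdr // => /dvdn_leq; rewrite subn_gt0 lt_rs => /(_ isT); lia.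
Qed.

Lemma root_count_pair_form k p : odd k -> prime p ->
  root_count (pair_form k) p <= 2 /\ root_count (pair_form k) p < p.
Proof.
move=> k_odd p_pr; case: (even_prime p_pr) => [->|p_odd].
  (* Modulo 2 the factor [2 m + k] is odd, so 0 is the only root. *)
  rewrite /root_count /pair_form !big_ord_recl big_ord0.
  by rewrite !dvdn2 !oddM !oddD !oddM k_odd.
have p_gt2 : 2 < p by case: p p_pr p_odd => [|[|[|p]]].
suff le2 : root_count (pair_form k) p <= 2 by split=> //; apply: leq_ltn_trans p_gt2.
have co : coprime p 2 by rewrite coprime_sym coprime2n.
apply: leq_trans (leq_add (root_count_id p) (root_count_linear k co)).
rewrite /root_count -big_split /=; apply: leq_sum => r _.
by rewrite /pair_form Euclid_dvdM //; do 2!case: (_ %| _).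
Qed.

Lemma exists_sift_base : exists2 w, 36 <= w &
  forall i, (\sum_(p <- sift_block w i) 2 / (p%:R - 2) <= 3 / 2 :> rat)%R.
Proof.
(* Hiding the value of [Z] keeps its huge powers from being computed. *)
have [Z Z_ge] : exists Z, 10000 <= Z by exists 10000.
have Z_gt0 : 0 < Z by apply: leq_trans Z_ge.
have le_exp n : 0 < n -> Z <= Z ^ n by move=> n_gt0; rewrite -{1}[Z]expn1 leq_pexp2l.
exists (Z ^ 600) => [|i]; first by apply: leq_trans (le_exp 600 isT); apply: leq_trans Z_ge.
(* Every level is again a 600th power, of [Z ^ (2 ^ i)]. *)
rewrite /sift_block sift_levelS /sift_level -expnM mulnC expnM.
apply: sum_double_inv_primes_square_le.
by apply: leq_trans Z_ge (le_exp _ _); rewrite expn_gt0.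
Qed.

(** With [t = C] the level is at least [36 ^ C = 6 ^ C * 6 ^ C]. *)
Lemma sift_level_large w C : 36 <= w ->
  exists t, C * 6 ^ t <= sift_level w t /\ C <= sift_level w t.
Proof.
move=> w_ge; suff le1 : C * 6 ^ C <= sift_level w C.
  by exists C; split=> //; apply: leq_trans le1; rewrite leq_pmulr // expn_gt0.
apply: leq_trans (_ : 6 ^ C * 6 ^ C <= _); first by rewrite leq_mul2r orbC ltnW // ltn_expl.
rewrite -expnMn; apply: leq_trans (_ : w ^ C <= _); last first.
  by rewrite leq_pexp2l ?(leq_trans _ w_ge) // ltnW // ltn_expl.
by case: C => [|C] //; rewrite leq_exp2r.
Qed.

Definition square_divisible (k z y m : nat) : bool :=
  has (fun p => (p ^ 2 %| m) || (p ^ 2 %| 2 * m + k)) (primes_in z y).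

Lemma sifted_pair_factorisation k z m : 0 < k < z -> 1 < z -> 1 < m < z ^ 22 ->
  sifted (pair_form k) z (z ^ 8) m -> ~~ square_divisible k z (z ^ 8) m ->
  z < m /\ exists s, [/\ all prime s, size s <= 13 & \prod_(p <- s) p = pair_form k m].
Proof.
case/andP=> k_gt0 kz z_gt1 /andP[m_gt1 m_lt] /andP[/allP free few] /hasPn sqf.
have m_gt0 : 0 < m by apply: ltnW.
have c_gt0 : 0 < 2 * m + k by lia.
have big p : prime p -> p %| pair_form k m -> z < p.
  move=> p_pr pm; rewrite ltnNge; apply/negP => pz.
  by have := free p; rewrite mem_primes_in p_pr prime_gt0 // pz pm => /(_ isT).
split.
  (* As [m > 1], it has a least prime factor, which exceeds [z]; this makes [m] as large as
     desired. *)
  apply: leq_trans (pdiv_leq m_gt0); apply: big; first exact: pdiv_prime.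
  by rewrite dvdn_mulr // pdiv_dvd.
have [s1 pr1 E1] := exists_prime_list m_gt0; have [s2 pr2 E2] := exists_prime_list c_gt0.
have zexp n : n < 24 -> z ^ n < z ^ 24 by move=> n24; rewrite ltn_exp2l.
have c1 : count (fun p => z ^ 8 < p) s1 <= 2.
  by apply: count_large_le2 => //; rewrite E1 (ltn_trans m_lt) // zexp.
have c2 : count (fun p => z ^ 8 < p) s2 <= 2.
  apply: count_large_le2 => //; rewrite E2.
  have : k < z ^ 22 by apply: leq_trans kz _; rewrite -{1}[z]expn1 leq_exp2l.
  have -> : z ^ 24 = z ^ 22 * (z * z) by rewrite mulnn -expnD.
  by have : 4 <= z * z; nia.
have prs : all prime (s1 ++ s2) by rewrite all_cat pr1 pr2.
have sE : \prod_(p <- s1 ++ s2) p = pair_form k m by rewrite big_cat E1 E2.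
exists (s1 ++ s2); split=> //.
have c3 : count (fun p => ~~ (z ^ 8 < p)) (s1 ++ s2) <= 9.
  rewrite -ltnS; apply: leq_ltn_trans few; rewrite -!size_filter.
  apply: uniq_leq_size => [|p]; last first.
    rewrite !mem_filter => /andP[py ps]; have p_pr := allP prs p ps.
    have pm : p %| pair_form k m by rewrite -sE dvdn_prod_mem.
    by rewrite pm p_pr mem_index_iota (big p) //= ltnS leqNgt py.
  apply: uniq_filter_squarefree => p py ps; have p_pr := allP prs p ps.
  have pm : p %| pair_form k m by rewrite -sE dvdn_prod_mem.
  have lt_zp := big p p_pr pm.
  have := sqf p; rewrite mem_primes_in p_pr lt_zp leqNgt py => /(_ isT).
  rewrite negb_or sE => /andP[sq1 sq2]; apply/negP; rewrite /pair_form.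
  (* A prime [p > z > k] cannot divide both [m] and [2 m + k], so [p ^ 2] would divide one of
     them. *)
  have [pdm|] := boolP (p %| m); last first.
    move=> pm'; rewrite Gauss_dvdr; first by apply/negP.
    by rewrite coprimeXl // prime_coprime.
  rewrite mulnC Gauss_dvdr; first by apply/negP.
  rewrite coprimeXl // prime_coprime // dvdn_addr ?dvdn_mull //.
  by apply/negP => /(dvdn_leq k_gt0); rewrite leqNgt (ltn_trans kz).
rewrite -(count_predC (fun p => z ^ 8 < p)) count_cat.
by have := c3; rewrite -[count (predC _) _]/(count (fun p => ~~ (z ^ 8 < p)) _); lia.
Qed.

(** * Discarding square divisors, and the final count *)

Local Open Scope ring_scope.

(** Telescoping: [1 / (x + 1)^2 <= 1 / x - 1 / (x + 1)]. *)
Lemma sum_inv_squares_le u v : (0 < u)%N ->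
  \sum_(p <- primes_in u v) (p%:R ^+ 2)^-1 <= u%:R^-1 :> rat.
Proof.
move=> u_gt0; rewrite big_filter /index_iota subSS.
apply: (@le_trans _ _ (\sum_(n <- iota u.+1 (v - u)) (n%:R ^+ 2)^-1)).
  rewrite big_mkcond; apply: ler_sum => n _; case: ifP => // _.
  by rewrite invr_ge0 exprn_ge0 ?ler0n.
move: (v - u)%N => n; elim: n u u_gt0 => [|n IHn] u u_gt0; first by rewrite big_nil invr_ge0 ler0n.
rewrite /= big_cons; apply: le_trans (lerD (lexx _) (IHn u.+1 isT)) _.
have u_gt0' : 0 < u%:R :> rat by rewrite ltr0n.
rewrite -natr1; move: (u%:R) u_gt0' => x x_gt0.
rewrite -subr_ge0.
have -> : x^-1 - ((((x + 1) ^+ 2)^-1) + (x + 1)^-1) = (x * (x + 1) ^+ 2)^-1.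
  by field; rewrite !lt0r_neq0 //; lra.
by rewrite invr_ge0 mulr_ge0 ?exprn_ge0; lra.
Qed.

Lemma count_root_le f N d : congruence_preserving f -> (0 < d)%N ->
  (root_count f d <= 1)%N ->
  \sum_(m < N) dvdn_ind f m d <= N%:R / d%:R + 1.
Proof.
move=> fP d_gt0 le1; have := count_dvdn_approx N fP d_gt0.
rewrite ler_norml => /andP[_]; rewrite lerBlDl => h; apply: le_trans h _.
have {}le1 : (root_count f d)%:R <= 1 :> rat by rewrite lern1.
by rewrite lerD // ler_wpM2l ?ler0n // ler_piMl // invr_ge0 ler0n.
Qed.

(** A union bound: each prime square has at most one root modulo it for either factor, the primes
    being odd. *)
Lemma square_divisible_count k z y N : (1 < z)%N ->
  (\sum_(m < N) ((m == 1 :> nat) || square_divisible k z y m))%N%:R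
    <= 1 + 2 * (N%:R / z%:R + y%:R) :> rat.
Proof.
move=> z_gt1.
have ind_le m : ((m == 1 :> nat) || square_divisible k z y m)%:R
    <= (m == 1%N)%:R + \sum_(p <- primes_in z y)
         (dvdn_ind id m (p ^ 2) + dvdn_ind (fun m => (2 * m + k)%N) m (p ^ 2)) :> rat.
  have S_ge0 l : 0 <= \sum_(p <- l)
         (dvdn_ind id m (p ^ 2) + dvdn_ind (fun m => (2 * m + k)%N) m (p ^ 2)).
    by apply: sumr_ge0 => p _; rewrite addr_ge0 ?ler0n.
  case: eqP => [_|_]; first by rewrite lerDl.
  rewrite add0r /square_divisible; elim: (primes_in z y) => [|p l IHl] /=; first by rewrite big_nil.
  rewrite big_cons; have := S_ge0 l; move: IHl; rewrite /dvdn_ind.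
  move: (\sum_(q <- l) _) => S IHl S_ge0'.
  case: (has _ l) IHl; case: (_ %| _)%N; case: (_ %| _)%N => /=; rewrite ?mulr1n ?mulr0n; lra.
rewrite natr_sum; apply: le_trans (ler_sum _ (fun (m : 'I_N) _ => ind_le m)) _.
rewrite big_split /=; apply: lerD.
  rewrite -natr_sum lern1 (sum_bool_card (fun m : 'I_N => m == 1%N :> nat)).
  apply/card_le1_eqP => r s; rewrite !unfold_in => /eqP r1 /eqP s1.
  by apply: val_inj; rewrite /= r1 s1.
rewrite exchange_big /=.
apply: (@le_trans _ _ (\sum_(p <- primes_in z y) 2 * (N%:R * (p%:R ^+ 2)^-1 + 1))).
  rewrite big_seq [leRHS]big_seq; apply: ler_sum => p.
  rewrite mem_primes_in => /and3P[p_pr zp _].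
  have p2_gt0 : (0 < p ^ 2)%N by rewrite expn_gt0 prime_gt0.
  have co : coprime (p ^ 2) 2.
    rewrite coprimeXl // coprime_sym coprime2n.
    by case: (even_prime p_pr) => // p2; rewrite p2 ltnNge z_gt1 in zp.
  rewrite big_split /= mulr2n mulrDl !mul1r -natrX; apply: lerD; apply: count_root_le => //.
  - exact: id_congruence_preserving.
  - exact: root_count_id.
  - exact: linear_congruence_preserving.
  - exact: root_count_linear.
rewrite -mulr_sumr ler_wpM2l // big_split /= -mulr_sumr lerD //.
  by rewrite ler_wpM2l ?ler0n // sum_inv_squares_le // ltnW.
rewrite big_const_seq count_predT iter_addr_0 ler_nat.
by apply: leq_trans (size_primes_in_le_bound _ _) (leq_subr _ _).
Qed.

Lemma exists_almost_prime_pair k T : odd k ->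
  exists2 m, (T < m)%N & exists s,
    [/\ all prime s, (size s <= 13)%N & (\prod_(p <- s) p)%N = pair_form k m].
Proof.
move=> k_odd; have k_gt0 : (0 < k)%N by case: k k_odd.
have [w w_ge blockP] := exists_sift_base.
have w_gt2 : (2 < w)%N by apply: leq_trans w_ge.
have rootP p (p_pr : prime p) := root_count_pair_form k_odd p_pr.
pose V := \prod_(p <- primes_in 0 w) (1 - local_density (pair_form k) p).
pose E := upper_weight w 0 1 (fun p => (root_count (pair_form k) p)%:R) 0.
have V_gt0 : 0 < V.
  apply: prod_small_gt0 => p p_pr; have [_ lt_p] := rootP p p_pr.
  by rewrite ltr_pdivrMr ?ltr0n ?prime_gt0 // mul1r ltr_nat.
have E_ge0 : 0 <= E by apply: esym_sum1_ge0 => p _; rewrite ler0n.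
(* The first summand makes the main term at least [(3 E + 6) z^21]. The losses [3 E z^20] and
   [1 + 2 (z^21 + z^8)] total at most [(3 E + 5) z^21]. The other summands give [k < z] and
   [T <= z]. *)
pose C := (Num.bound (10 * (3 * E + 6) / V) + k.+1 + T)%N.
have CE : C = (Num.bound (10 * (3 * E + 6) / V) + k.+1 + T)%N by [].
clearbody C.
have [t [zC zC']] := sift_level_large C w_ge.
set z := sift_level w t in zC zC'.
have z_gt1 : (1 < z)%N by rewrite sift_level_gt1 // ltnW.
have kz : (k < z)%N by apply: leq_trans zC'; rewrite CE; lia.
have Tz : (T <= z)%N by apply: leq_trans zC'; rewrite CE; lia.
have := sifted_count (t := t) (z ^ 22) (pair_form_congruence_preserving k)
  w_gt2 blockP rootP erefl erefl erefl.
rewrite -/V -/E -/z => count_ge; clearbody z.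
have bad_le := square_divisible_count k (z ^ 8) (z ^ 22) z_gt1.
have [/existsP[[m m_lt] /= /andP[m_sift]]|/existsPn none] := boolP [exists m : 'I_(z ^ 22),
    sifted (pair_form k) z (z ^ 8) m && ~~ ((m == 1 :> nat) || square_divisible k z (z ^ 8) m)].
  rewrite negb_or => /andP[m_neq1 m_sqf].
  have m_neq0 : m != 0%N.
    apply: contraTneq m_sift => ->; apply/negP => /andP[/allP/(_ 2) + _].
    by rewrite mem_primes_in /pair_form mul0n dvdn0 => /(_ z_gt1).
  have kz2 : (0 < k < z)%N by rewrite k_gt0.
  have m_rng : (1 < m < z ^ 22)%N by rewrite m_lt andbT; lia.
  have [z_lt s_ex] := sifted_pair_factorisation kz2 z_gt1 m_rng m_sift m_sqf.
  by exists m => //; apply: leq_ltn_trans z_lt.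
(* If every sifted [m] were discarded, the lower bound for the sifted set would be at most the upper
   bound for the discarded one. *)
have le_bad : (\sum_(m < z ^ 22) sifted (pair_form k) z (z ^ 8) m
    <= \sum_(m < z ^ 22) ((m == 1 :> nat) || square_divisible k z (z ^ 8) m))%N.
  by apply: leq_sum => m _; have := none m; case: (sifted _ _ _ _); case: (_ || _).
move: le_bad; rewrite -(ler_nat rat) => le_bad.
have := le_trans count_ge (le_trans le_bad bad_le).
have zr : C%:R * 6 ^+ t <= z%:R :> rat by rewrite -natrX -natrM ler_nat.
have D_ge0 : 0 <= 10 * (3 * E + 6) / V.
  by apply: divr_ge0; [move: E_ge0; clear; lra | exact: ltW].
have C_ge : 10 * (3 * E + 6) / V <= C%:R.
  apply: le_trans (ltW (archi_boundP D_ge0)) _.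
  by rewrite ler_nat CE -addnA leq_addr.
have z_ge1 : 1 <= z%:R :> rat by rewrite ler1n ltnW.
have z_neq0 : z%:R != 0 :> rat by rewrite pnatr_eq0 -lt0n ltnW.
have q_ge0 : 0 <= (1 / 6 : rat) ^+ t by apply: exprn_ge0; lra.
have q6 : 6 ^+ t * (1 / 6) ^+ t = 1 :> rat.
  have q1 : 6 * (1 / 6) = 1 :> rat by lra.
  by rewrite -exprMn q1 expr1n.
have Cq : C%:R <= z%:R * (1 / 6) ^+ t :> rat.
  by have := ler_wpM2r q_ge0 zr; rewrite -mulrA q6 mulr1.
have le6 : 3 * E + 6 <= z%:R * (1 / 6) ^+ t * V / 10.
  have := le_trans C_ge Cq; rewrite ler_pdivrMr //.
  by move: (_ * V) => X; clear; lra.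
rewrite !natrX.
have z8 : z%:R ^+ 8 <= z%:R ^+ 21 :> rat by apply: ler_weXn2l.
have z20 : z%:R ^+ 20 <= z%:R ^+ 21 :> rat by apply: ler_weXn2l.
have z21 : 1 <= z%:R ^+ 21 :> rat by apply: exprn_ege1.
have -> : z%:R ^+ 22 / z%:R = z%:R ^+ 21 :> rat by rewrite exprSr mulfK.
have -> : z%:R ^+ 22 * (V * (1 / 6) ^+ t / 10)
    = z%:R ^+ 21 * (z%:R * (1 / 6) ^+ t * V / 10) by rewrite exprSr; ring.
have z21_ge0 := le_trans ler01 z21.
have h1 := ler_wpM2l z21_ge0 le6; have h2 := ler_wpM2l E_ge0 z20.
move: h1 h2 z8 z21; move: (_ / 10) (_ ^+ 8) (_ ^+ 20) (_ ^+ 21) => X x8 x20 x21.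
clear; lra.
Qed.

(** * Zariski density *)

Lemma poly_many_roots_eq0 (R : numDomainType) (q : {poly R}) :
  (forall T : nat, exists2 m, (T < m)%N & q.[m%:R] = 0) -> q = 0.
Proof.
move=> many; have [s [uniq_s size_s root_s _]] : exists s : seq nat,
    [/\ uniq s, size s = size q, all (fun m => root q m%:R) s &
       exists B, all (fun m => m <= B)%N s].
  elim: (size q) => [|n [s [uniq_s <- root_s [B le_B]]]]; first by exists [::]; split=> //; exists 0%N.
  have [m lt_Bm qm0] := many B; exists (m :: s); split=> /=.
  - rewrite uniq_s andbT; apply/negP => /(allP le_B); by rewrite leqNgt lt_Bm.
  - by [].
  - by rewrite root_s andbT; apply/eqP.
  - exists m; rewrite leqnn; apply/allP => p /(allP le_B) pB.
    exact: leq_trans pB (ltnW lt_Bm).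
apply/eqP/negPn/negP => q_neq0.
have un : uniq [seq m%:R : R | m <- s].
  by rewrite map_inj_uniq // => i j /eqP; rewrite eqr_nat => /eqP.
have rs : all (root q) [seq m%:R | m <- s] by rewrite all_map.
by have := max_poly_roots q_neq0 rs un; rewrite size_map size_s ltnn.
Qed.

Lemma poly_everywhere_eq0 (R : numDomainType) (q : {poly R}) :
  (forall t, q.[t] = 0) -> q = 0.
Proof. by move=> q0; apply: poly_many_roots_eq0 => T; exists T.+1. Qed.

Lemma meval_curve n (R : comNzRingType) (p : {mpoly R[n]}) (v : 'I_n -> {poly R}) :
  exists q : {poly R}, forall t, q.[t] = p.@[fun i => (v i).[t]].
Proof.
exists (\sum_(m <- msupp p) (p@_m)%:P * \prod_i v i ^+ m i) => t.
rewrite mevalE horner_sum; apply: eq_bigr => m _; rewrite hornerM hornerC horner_prod.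
by congr (_ * _); apply: eq_bigr => i _; rewrite horner_exp.
Qed.

Lemma meval_homog_scale n (R : comNzRingType) (p : {mpoly R[n]}) d c (v w : 'I_n -> R) :
  p \is d.-homog -> (forall i, w i = c * v i) -> p.@[w] = c ^+ d * p.@[v].
Proof.
move=> /dhomogP p_hom wE; rewrite !mevalE mulr_sumr big_seq [RHS]big_seq.
apply: eq_bigr => m m_in; rewrite mulrCA; congr (_ * _).
have <- : mdeg m = d := p_hom m m_in.
rewrite mdegE -prodrXr -big_split /=.
by apply: eq_bigr => i _; rewrite wE exprMn.
Qed.

(** * The affine chart and its almost prime points *)

Lemma map_cox_map (R S : comNzRingType) (phi : {rmorphism R -> S}) e1 e2 e3 e4 a1 a2 a3 :
  map_mx phi (cox_map e1 e2 e3 e4 a1 a2 a3)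
  = cox_map (phi e1) (phi e2) (phi e3) (phi e4) (phi a1) (phi a2) (phi a3).
Proof.
apply/rowP => -[[|[|[|[|[|[|[|]]]]]]] //= lt_i7]; rewrite !mxE /=;
  by rewrite !(rmorphM, rmorphXn).
Qed.

Lemma cox_image_neq0 (e1 e2 e3 e4 a1 a2 a3 : algC) :
  e1 != 0 -> e2 != 0 -> e3 != 0 -> e4 != 0 -> cox_map e1 e2 e3 e4 a1 a2 a3 != 0.
Proof.
move=> e1n e2n e3n e4n; apply: contraNneq (_ : e1 ^+ 4 * e2 ^+ 2 * e3 ^+ 3 * e4 ^+ 3 != 0).
  by move/rowP/(_ (inord 5)); rewrite !mxE inordK //= => ->.
by rewrite !mulf_neq0 ?expf_neq0.
Qed.

Lemma cox_image_X0 y : cox_image y -> X0 y.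
Proof.
move=> y_im; split; last by move=> d p _; apply.
by case: y_im => [e1 [e2 [e3 [e4 [a1 [a2 [a3 []]]]]]]].
Qed.

Definition chart_point (R : comNzRingType) (a b : R) : 'rV[R]_7 :=
  cox_map 1 1 1 1 a b (- (a ^+ 2 + b)).

Lemma chart_pointE (R : comNzRingType) (a b : R) i :
  chart_point a b 0 i =
  [:: - (b * (a ^+ 2 + b)); a * b; - (a * (a ^+ 2 + b)); b; - (a ^+ 2 + b); 1; a]`_i.
Proof.
rewrite mxE; case: i => -[|[|[|[|[|[|[|]]]]]]] //= _; rewrite ?expr1n; ring.
Qed.

Lemma map_chart_point (R S : comNzRingType) (phi : {rmorphism R -> S}) a b :
  map_mx phi (chart_point a b) = chart_point (phi a) (phi b).
Proof. by rewrite map_cox_map !rmorph1 rmorphN rmorphD rmorphXn. Qed.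

Lemma chart_point_X0 (a b : algC) : X0 (chart_point a b).
Proof.
apply: cox_image_X0; exists 1, 1, 1, 1, a, b, (- (a ^+ 2 + b)); split=> //.
  by rewrite !mul1r subrr.
by rewrite cox_image_neq0 ?oner_neq0.
Qed.

Lemma chart_point_primitive (a b : int) : primitive_vector (chart_point a b).
Proof.
apply/eqP; rewrite -dvdn1; apply: (biggcdn_inf (inord 5)) => //.
by rewrite chart_pointE inordK.
Qed.

Lemma coord_product_chart_point (a b : int) :
  coord_product.@[chart_point a b 0] = - (a * b * (a ^+ 2 + b)) ^+ 3.
Proof.
rewrite /coord_product rmorph_prod /=.
under eq_bigr do rewrite mevalXU chart_pointE.
by rewrite !big_ord_recl big_ord0 /=; ring.
Qed.

Lemma chart_point_almost_prime (a m : nat) (s : seq nat) :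
  prime a -> all prime s -> (size s <= 13)%N ->
  (\prod_(p <- s) p)%N = pair_form (a ^ 2) m ->
  almost_prime_points X0 coord_product 45 (chart_point a%:R (2 * m%:R)).
Proof.
move=> a_pr prs size_s sE; exists (chart_point a%:Z (2 * m%:Z)); split.
- split; first exact: chart_point_primitive.
  by rewrite map_chart_point; apply: chart_point_X0.
- rewrite coord_product_chart_point; pose l := a :: 2%N :: s.
  (* The coordinate product is a cube up to sign, and [l] has at most [1 + 1 + 13 = 15] primes. *)
  exists (l ++ l ++ l); split.
  + by rewrite !all_cat /= a_pr prs.
  + by rewrite !size_cat /=; lia.
  have lE : (\prod_(p <- l) p = a * (2 * m) * (a ^ 2 + 2 * m))%N.
    by rewrite !big_cons sE /pair_form; ring.
  by rewrite !big_cat lE /= abszN abszX !abszM /= -!mulnn; nia.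
- by rewrite map_chart_point rmorphM /= -!pmulrn.
Qed.

(** * Vanishing on the image of the parametrisation *)

Section Density.
Variables (d : nat) (p : {mpoly algC[7]}).
Hypothesis p_homog : p \is d.-homog.
Hypothesis p_vanish : forall y, almost_prime_points X0 coord_product 45 y -> p.@[y 0] = 0.

Lemma meval_poly_row (V : 'rV[{poly algC}]_7) :
  exists q : {poly algC}, forall t, q.[t] = p.@[map_mx (horner_eval t) V 0].
Proof.
have [q qE] := meval_curve p (V 0); exists q => t; rewrite qE.
by apply: meval_eq => i; rewrite mxE.
Qed.

Lemma vanish_chart_nat (a : nat) (b : algC) : prime a -> odd a ->
  p.@[chart_point a%:R b 0] = 0.
Proof.
move=> a_pr a_odd.
have [q qE] := meval_poly_row (chart_point (a%:R)%:P (2 *: 'X)).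
have {}qE t : q.[t] = p.@[chart_point a%:R (2 * t) 0].
  by rewrite qE map_chart_point /= /horner_eval hornerC hornerZ hornerX.
have q0 : q = 0.
  apply: poly_many_roots_eq0 => T.
  have a2_odd : odd (a ^ 2) by rewrite oddX a_odd orbT.
  have [m Tm [s [prs size_s sE]]] := exists_almost_prime_pair T a2_odd.
  exists m => //; rewrite qE; apply: p_vanish.
  exact: chart_point_almost_prime a_pr prs size_s sE.
by have := qE (b / 2); rewrite q0 horner0 [2 * _]mulrC divfK ?pnatr_eq0 // => <-.
Qed.

Lemma vanish_chart (a b : algC) : p.@[chart_point a b 0] = 0.
Proof.
have [q qE] := meval_poly_row (chart_point 'X b%:P).
have {}qE t : q.[t] = p.@[chart_point t b 0].
  by rewrite qE map_chart_point /= /horner_eval hornerX hornerC.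
have q0 : q = 0.
  apply: poly_many_roots_eq0 => T; have [a' lt_a a_pr] := prime_above (maxn T 2).
  exists a'; first by apply: leq_ltn_trans lt_a; rewrite leq_maxl.
  rewrite qE vanish_chart_nat //; case: (even_prime a_pr) => // a2.
  by rewrite a2 gtn_max ltnn andbF in lt_a.
by rewrite -qE q0 horner0.
Qed.

Lemma vanish_torus (e1 e2 e3 e4 a1 a2 a3 : algC) :
  e1 != 0 -> e2 != 0 -> e3 != 0 -> e4 != 0 ->
  e2 * a1 ^+ 2 + e3 * a2 + e4 * a3 = 0 ->
  p.@[cox_map e1 e2 e3 e4 a1 a2 a3 0] = 0.
Proof.
move=> e1n e2n e3n e4n eq0.
have a3E : a3 = - (e2 * a1 ^+ 2 + e3 * a2) / e4.
  by apply: (mulfI e4n); rewrite [RHS]mulrC divfK //; apply/eqP; rewrite -addr_eq0 addrC eq0.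
(* Here [c] is the coordinate [x_5], which is 1 on the chart; [a] and [b] are [x_6 / x_5] and
   [x_3 / x_5]. *)
pose c := e1 ^+ 4 * e2 ^+ 2 * e3 ^+ 3 * e4 ^+ 3.
pose a := a1 / (e1 * e3 * e4); pose b := a2 / (e1 ^+ 2 * e2 * e3 * e4 ^+ 2).
rewrite (meval_homog_scale (c := c) (v := chart_point a b 0) p_homog) ?vanish_chart ?mulr0 // => i.
rewrite chart_pointE mxE a3E /a /b /c.
by case: i => -[|[|[|[|[|[|[|]]]]]]] //= _; field; rewrite ?e1n ?e2n ?e3n ?e4n.
Qed.

(** On a curve along which no [E_i] is identically zero, the product of [q] with the [E_i] vanishes
    at every parameter, so [q = 0], also at parameters where some [E_i] vanishes. *)
Lemma vanish_curve (E1 E2 E3 E4 A1 A2 A3 : {poly algC}) t :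
  E1 * E2 * E3 * E4 != 0 -> E2 * A1 ^+ 2 + E3 * A2 + E4 * A3 = 0 ->
  p.@[cox_map E1.[t] E2.[t] E3.[t] E4.[t] A1.[t] A2.[t] A3.[t] 0] = 0.
Proof.
move=> En eq0; have [q qE] := meval_poly_row (cox_map E1 E2 E3 E4 A1 A2 A3).
have {}qE u : q.[u] = p.@[cox_map E1.[u] E2.[u] E3.[u] E4.[u] A1.[u] A2.[u] A3.[u] 0].
  by rewrite qE map_cox_map.
suff /eqP : q * (E1 * E2 * E3 * E4) = 0.
  by rewrite mulf_eq0 (negPf En) orbF -qE => /eqP ->; rewrite horner0.
apply: poly_everywhere_eq0 => u; rewrite !hornerM qE.
have [/eqP|] := eqVneq (E1.[u] * E2.[u] * E3.[u] * E4.[u]) 0.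
  by move=> /eqP ->; rewrite mulr0.
rewrite !mulf_eq0 !negb_or => /andP[/andP[/andP[e1n e2n] e3n] e4n].
rewrite vanish_torus ?mul0r //.
by have /(congr1 (horner^~ u)) := eq0; rewrite !hornerE.
Qed.

Lemma addX_neq0 (e : algC) : e%:P + 'X != 0.
Proof. by rewrite addrC -[e%:P]opprK -polyCN polyXsubC_eq0. Qed.

(** The curve shifts [e1], [e2], [e3] by the parameter and solves the equation for [a3], which is
    possible as [e4] is invertible; it passes through the given point at 0. *)
Lemma vanish_e4 (e1 e2 e3 e4 a1 a2 a3 : algC) : e4 != 0 ->
  e2 * a1 ^+ 2 + e3 * a2 + e4 * a3 = 0 ->
  p.@[cox_map e1 e2 e3 e4 a1 a2 a3 0] = 0.
Proof.
move=> e4n eq0; pose E e : {poly algC} := e%:P + 'X.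
pose A3 := - (E e2 * a1%:P ^+ 2 + E e3 * a2%:P) * (e4^-1)%:P.
have E0 e : (E e).[0] = e by rewrite /E hornerD hornerC hornerX addr0.
have A30 : A3.[0] = a3.
  rewrite /A3 hornerM hornerN hornerD !hornerM !E0 !hornerC; apply: (mulfI e4n).
  rewrite [LHS]mulrC divfK //; apply/eqP; rewrite eq_sym -addr_eq0.
  by rewrite -[X in _ == X]eq0; apply/eqP; ring.
have := @vanish_curve (E e1) (E e2) (E e3) e4%:P a1%:P a2%:P A3 0.
rewrite !E0 A30 !hornerC; apply.
  by rewrite !mulf_neq0 ?addX_neq0 ?polyC_eq0.
by rewrite /A3 [e4%:P * _]mulrCA -polyCM mulfV // mulr1 addrN.
Qed.

Lemma vanish_e3 (e1 e2 e3 e4 a1 a2 a3 : algC) : e3 != 0 ->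
  e2 * a1 ^+ 2 + e3 * a2 + e4 * a3 = 0 ->
  p.@[cox_map e1 e2 e3 e4 a1 a2 a3 0] = 0.
Proof.
move=> e3n eq0; pose E e : {poly algC} := e%:P + 'X.
pose A2 := - (E e2 * a1%:P ^+ 2 + E e4 * a3%:P) * (e3^-1)%:P.
have E0 e : (E e).[0] = e by rewrite /E hornerD hornerC hornerX addr0.
have A20 : A2.[0] = a2.
  rewrite /A2 hornerM hornerN hornerD !hornerM !E0 !hornerC; apply: (mulfI e3n).
  rewrite [LHS]mulrC divfK //; apply/eqP; rewrite eq_sym -addr_eq0.
  by rewrite -[X in _ == X]eq0; apply/eqP; ring.
have := @vanish_curve (E e1) (E e2) e3%:P (E e4) a1%:P A2 a3%:P 0.
rewrite !E0 A20 !hornerC; apply.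
  by rewrite !mulf_neq0 ?addX_neq0 ?polyC_eq0.
by rewrite /A2 [e3%:P * _]mulrCA -polyCM mulfV // mulr1 addrAC addrN.
Qed.

Lemma vanish_cox_image y : cox_image y -> p.@[y 0] = 0.
Proof.
case=> [e1 [e2 [e3 [e4 [a1 [a2 [a3 [eq0 -> y_neq0]]]]]]]].
have [e4_0|e4n] := eqVneq e4 0; last exact: vanish_e4.
have [e3_0|e3n] := eqVneq e3 0; last exact: vanish_e3.
(* With [e3 = e4 = 0] only the coordinate [a2 * a3] can be nonzero, so [a2 = 0] would give the zero
   vector. *)
have [a20|a2n] := eqVneq a2 0.
  case/eqP: y_neq0; apply/rowP => i; rewrite !mxE e4_0 e3_0 a20.
  by case: i => -[|[|[|[|[|[|[|]]]]]]] //= _; rewrite !(expr0n, mul0r, mulr0).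
(* The point is (a2 a3 : 0 : ... : 0), which also has a preimage with [e4 = 1]. *)
have -> : cox_map e1 e2 e3 e4 a1 a2 a3 = cox_map 0 0 (- a3 / a2) 1 0 a2 a3.
  apply/rowP => i; rewrite !mxE e4_0 e3_0.
  by case: i => -[|[|[|[|[|[|[|]]]]]]] //= _; rewrite !(expr0n, mul0r, mulr0).
by apply: vanish_e4; rewrite ?oner_neq0 // expr0n mulr0 add0r divfK // mul1r addNr.
Qed.

End Density.

Lemma almost_prime_points_dense :
  zariski_dense_in (almost_prime_points X0 coord_product 45) X0.
Proof.
split=> [y [x [[_ X0x] _ ->]] //|y [y_neq0 X0y]]; split=> // d p p_homog p_vanish.
by apply: (X0y d p p_homog) => z; apply: vanish_cox_image p_homog p_vanish z.
Qed.

(** Density is not a decidable predicate, so excluded middle decides whether a smaller witness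
    exists. *)
Lemma exists_least (P : nat -> Prop) n : P n ->
  exists2 m, (P m /\ forall k, P k -> (m <= k)%N) & (m <= n)%N.
Proof.
elim/ltn_ind: n => n IHn Pn.
have [[m [lt_mn Pm]]|none] := classic (exists m, (m < n)%N /\ P m).
  have [k least le_km] := IHn m lt_mn Pm; exists k => //.
  exact: leq_trans le_km (ltnW lt_mn).
exists n => //; split=> // k Pk; rewrite leqNgt; apply/negP => lt_kn.
by apply: none; exists k.
Qed.

Theorem theorem1p2 :
  (exists2 r : nat, is_saturation_number X0 coord_product r & (r <= 45)%N) /\
  zariski_dense_in (almost_prime_points X0 coord_product 45) X0.
Proof.
split; last exact: almost_prime_points_dense.
exact: (exists_least (P := fun r => zariski_dense_in (almost_prime_points X0 coord_product r) X0))
  almost_prime_points_dense.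
Qed.
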